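(* Let $G_k$ be a sequence of finite connected graphs with distinguished vertices $v_k$. Assume that $$(1+o(1))\max_{x\in G_k}\deg_*(x)=k=(1+o(1))\min_{x\in G_k}\deg_*(x)$$ as $k\to\infty$, and that, uniformly in (non-self) edges $e,f$ of $G_k$, $$M(e,f)=k^{-1}\big(|e\cap f|+o(1)\big).$$ Let $\mathbf{T}_k$ be the uniform random spanning tree of $G_k$, rooted at $v_k$. Then $\mathbf{T}_k$ converges in distribution to $\mathcal{P}_1$.
   Context: For a vertex $x$ of a finite graph, $\deg_*(x)$ is the number of edges incident to $x$ that are not self-edges; $|e\cap f|$ is the number of common endpoints of $e$ and $f$ (so $|e\cap e|=2$). The transfer impedance $M(e,f)$ of two oriented edges $e=\vec{xy}$, $f=\vec{zw}$ of a finite connected graph is $\phi(z)-\phi(w)$, where $\phi$ is the function on vertices (unique up to an additive constant) with $\sum_{\text{edges } ab}(\phi(a)-\phi(b))=\delta_x(a)-\delta_y(a)$ for every vertex $a$ (sum over edges at $a$). In the hypothesis on $M(e,f)$, $e$ and $f$ are oriented so that at a common endpoint they either both point away from it or both point towards it (with $e=f$ given the same orientation). For a locally finite rooted tree $T$, $T\wedge r$ is the finite rooted subtree of vertices connected to the root by paths of length at most $r$. Tree-valued random variables $T_k$ converge in distribution to $T$ if $\mathbf{P}(T_k\wedge r=t)\to\mathbf{P}(T\wedge r=t)$ for every $r$ and every finite rooted tree $t$ of height at most $r$ (rooted trees being identified up to isomorphism). $\mathcal{P}_1$ is the random rooted tree consisting of a singly infinite path $x_0,x_1,x_2,\dots$,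 rooted at $x_0$, to which has been attached at each $x_i$ the family tree (rooted at $x_i$) of an independent Galton–Watson branching process with Poisson(1) offspring distribution. *)

(* Defs.v *)
From HB Require Import structures.
From mathcomp Require Import all_boot all_order all_algebra.
From mathcomp Require Import all_classical all_reals all_analysis.

Set Implicit Arguments.
Unset Strict Implicit.
Unset Printing Implicit Defensive.

Import Order.TTheory GRing.Theory Num.Theory.
Import numFieldNormedType.Exports.

Local Open Scope classical_set_scope.
Local Open Scope ring_scope.

(* Finite multigraphs; self-edges and parallel edges are allowed. [src] and
   [tgt] give every edge an arbitrary reference orientation. *)
Record mgraph := MGraph {
  vertex : finType;
  edge : finType;
  src : edge -> vertex;
  tgt : edge -> vertex }.

(* [(e, true)] is [e] oriented from [src e] to [tgt e], [(e, false)] is [e]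
   with the opposite orientation. *)
Definition oedge (G : mgraph) : finType := (edge G * bool)%type.

Section Graph.
Context (G : mgraph).
Implicit Types (x y a : vertex G) (e f : edge G) (d : oedge G).

Definition otail d : vertex G := if d.2 then src d.1 else tgt d.1.
Definition ohead d : vertex G := if d.2 then tgt d.1 else src d.1.

Definition self_edge e : bool := src e == tgt e.

Definition endpoints e : {set vertex G} := [set src e; tgt e]%SET.

Definition deg_star x : nat := #|[set e | ~~ self_edge e & x \in endpoints e]%SET|.

Definition max_deg_star : nat := \max_(x : vertex G) deg_star x.

(* The vertex [v] only witnesses that the set of vertices is nonempty. *)
Definition min_deg_star (v : vertex G) : nat :=
  \big[minn/deg_star v]_(x : vertex G) deg_star x.

Definition common_endpoints e f : nat := #|endpoints e :&: endpoints f|.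

Definition edge_adj (S : {set edge G}) : rel (vertex G) :=
  fun x y => [exists d : oedge G, [&& d.1 \in S, otail d == x & ohead d == y]].

Definition connected_by (S : {set edge G}) : Prop :=
  forall x y, connect (edge_adj S) x y.

Definition connected_graph : Prop := connected_by [set: edge G]%SET.

(* Closed walks through distinct vertices and distinct edges of [S]; a
   self-edge and a pair of parallel edges are cycles. *)
Definition is_cycle (S : {set edge G}) (c : seq (oedge G)) : bool :=
  [&& c != [::], all (fun d => d.1 \in S) c,
      cycle (fun d d' => ohead d == otail d') c,
      uniq (map otail c) & uniq (map fst c)].

Definition spanning_tree (S : {set edge G}) : Prop :=
  connected_by S /\ (forall c, ~~ is_cycle S c).

Definition spanning_trees : {set {set edge G}} :=
  [set S | `[< spanning_tree S >]]%SET.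

Section TransferImpedance.
Context {R : realType}.

(* The edges at [a] are listed as the oriented edges with tail [a]; a
   self-edge contributes only zero terms. *)
Definition is_potential x y (phi : vertex G -> R) : Prop :=
  forall a, \sum_(d : oedge G | otail d == a) (phi (otail d) - phi (ohead d))
            = (a == x)%:R - (a == y)%:R.

Definition potential x y : vertex G -> R :=
  xget (fun=> 0) [set phi | is_potential x y phi].

Definition transfer_impedance d d' : R :=
  let phi := potential (otail d) (ohead d) in phi (otail d') - phi (ohead d').

End TransferImpedance.

(* At a common endpoint, both oriented edges point away from it or both point
   towards it. *)
Definition compatibly_oriented d d' : Prop :=
  forall a, a \in endpoints d.1 -> a \in endpoints d'.1 ->
    (otail d = a /\ otail d' = a) \/ (ohead d = a /\ ohead d' = a).

End Graph.

(* [b k = (1 + o(1)) a k] as [k] tends to infinity. *)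
Definition one_plus_o1_times {R : realType} (a b : nat -> R) : Prop :=
  exists2 eps : nat -> R, eps @ \oo --> (0 : R)
    & \forall k \near \oo, b k = (1 + eps k) * a k.

(* [M(e,f) = k^-1 (|e /\ f| + o(1))], uniformly in compatibly oriented edges
   [e], [f] that are not self-edges. *)
Definition uniform_impedance (R : realType) (G : nat -> mgraph) : Prop :=
  forall eps : R, 0 < eps -> \forall k \near \oo,
    forall d d' : oedge (G k),
      ~~ self_edge d.1 -> ~~ self_edge d'.1 -> compatibly_oriented d d' ->
      exists2 delta : R, `|delta| < eps
        & transfer_impedance d d'
          = k%:R^-1 * ((common_endpoints d.1 d'.1)%:R + delta).

(* A rooted graph whose vertices are the elements of [rcarrier] satisfying
   [rvert]; [radj] is only meaningful on those. *)
Record rgraph := RGraph {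
  rcarrier : Type;
  rvert : pred rcarrier;
  radj : rel rcarrier;
  rroot : rcarrier }.

Definition within (T : rgraph) (r : nat) (x : rcarrier T) : Prop :=
  exists p : seq (rcarrier T),
    [/\ all (@rvert T) (rroot T :: p), path (@radj T) (rroot T) p,
        last (rroot T) p = x & (size p <= r)%N].
Arguments within : clear implicits.

(* [T /\ r] *)
Definition trunc (T : rgraph) (r : nat) : rgraph :=
  RGraph (fun x => `[< within T r x >]) (@radj T) (rroot T).

Definition riso (T T' : rgraph) : Prop :=
  exists f : rcarrier T -> rcarrier T',
    [/\ set_bij [set x | rvert x] [set x | rvert x] f,
        f (rroot T) = rroot T'
      & forall x y, rvert x -> rvert y -> radj (f x) (f y) = radj x y].

Definition is_tree (V : finType) (e : rel V) : Prop :=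
  [/\ symmetric e, irreflexive e, (forall x y, connect e x y)
    & forall c, ucycle e c -> (size c <= 2)%N].

Definition finite_rgraph (V : finType) (e : rel V) (o : V) : rgraph :=
  RGraph xpredT e o.

Definition height_le (T : rgraph) (r : nat) : Prop :=
  forall x : rcarrier T, rvert x -> within T r x.

(* A tree-valued random variable enters through its law
   [A |-> P(T \in A)], with [A] ranging over properties of rooted graphs
   (the universe of [rgraph] is too large for [set rgraph]). *)
Definition conv_in_distribution {R : realType}
    (lk : nat -> (rgraph -> Prop) -> R) (l : (rgraph -> Prop) -> R) : Prop :=
  forall (r : nat) (V : finType) (e : rel V) (o : V),
    let t := finite_rgraph e o in
    is_tree e -> height_le t r ->
    (fun k => lk k (fun T => riso (trunc T r) t)) @ \oo
      --> l (fun T => riso (trunc T r) t).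

Definition law {R : realType} d (Omega : measurableType d)
    (P : probability Omega R) (X : Omega -> rgraph) (A : rgraph -> Prop) : R :=
  fine (P [set omega | A (X omega)]).

Definition rooted_subgraph (G : mgraph) (v : vertex G) (S : {set edge G}) :
  rgraph := RGraph xpredT (edge_adj S) v.

Definition ust_law (R : realType) (G : mgraph) (v : vertex G)
    (A : rgraph -> Prop) : R :=
  #|[set S in spanning_trees G | `[< A (rooted_subgraph v S) >]]%SET|%:R
  / #|spanning_trees G|%:R.

(* Family trees in Ulam-Harris coding: the individual [u] has [n u] children,
   namely [rcons u c] for [c < n u]; the ancestor is [::]. *)
Definition family_vert (n : seq nat -> nat) (u : seq nat) : bool :=
  all (fun l => nth 0%N u l < n (take l u))%N (iota 0 (size u)).

Definition is_child (u w : seq nat) : bool :=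
  (w != [::]) && (w == rcons u (last 0%N w)).

Definition family_adj (u w : seq nat) : bool := is_child u w || is_child w u.

(* The path [(0, [::]), (1, [::]), ...] rooted at its first vertex, with the
   family tree of [n i] attached at [(i, [::])]. *)
Definition path_with_family_trees (n : nat -> seq nat -> nat) : rgraph :=
  @RGraph (nat * seq nat)%type
    (fun x => family_vert (n x.1) x.2)
    (fun x y => (x.1 == y.1) && family_adj x.2 y.2
       || [&& x.2 == [::], y.2 == [::] & (x.1 == y.1.+1) || (y.1 == x.1.+1)])
    (0%N, [::]).

Definition mutually_independent {R : realType} d (Omega : measurableType d)
    (P : probability Omega R) (I : eqType) (X : I -> Omega -> nat) : Prop :=
  forall (s : seq I) (A : I -> set nat), uniq s ->
    P (\bigcap_(i in [set i | i \in s]) (X i @^-1` A i))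
    = (\prod_(i <- s) P (X i @^-1` A i))%E.

(* Independent Poisson(1) offspring numbers of all potential individuals [u]
   of the family trees at the vertices [x_i] of the path. *)
Definition poisson1_offspring {R : realType} d (Omega : measurableType d)
    (P : probability Omega R) (xi : nat -> seq nat -> {RV P >-> nat}) : Prop :=
  (forall i u n, P (xi i u @^-1` [set n]) = (poisson_pmf 1 n)%:E)
  /\ mutually_independent P
       (fun iu : nat * seq nat => xi iu.1 iu.2 : Omega -> nat).

Definition P1_tree {R : realType} d (Omega : measurableType d)
    (P : probability Omega R) (xi : nat -> seq nat -> {RV P >-> nat})
    (omega : Omega) : rgraph :=
  path_with_family_trees (fun i u => xi i u omega).

(* Main.v *)
(** The law of a ball in a random tree is recovered from the mean numbers of
    copies of finite rooted trees in it.

    By the transfer impedance theorem, the probability that the uniform spanning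
    tree contains a given copy of a tree with [m] edges in [G k] is the
    determinant of the transfer impedances of these edges. Orienting the edges
    from one colour class to the other, it is [k^-m (det (C^T C) + o(1))], where
    [C] is the unsigned incidence matrix of the tree, and [det (C^T C) = m + 1].
    As [G k] is nearly regular and Kirchhoff's law forces multiplicities of edges
    to be [o(k)], there are [k^m (1 + o(1))] copies containing the root, so that
    the mean number of rooted copies in the spanning tree tends to [m + 1].

    Let [t] be a tree of height at most [r] with [n] vertices, [a] of them at
    depth less than [r]. A copy of [t] is the whole ball of radius [r] if and only
    if its [a] inner vertices have no further neighbours; applying the Bonferroni
    inequalities to the copies of [t] with [j] leaves added to inner vertices, the
    mean number of isomorphisms from [t] to the ball tends to the sum of
    [(-1)^j a^j (n + j) / j!], that is, to [(n - a) exp (-a)].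

    In the limit tree, an isomorphism from [t] to the ball is given by the vertex
    of depth [r] on the infinite path, for which there are [n - a] choices, and
    the birth orders of the children; each choice of the former contributes
    [exp (-a)]. *)

Require Import Defs.
From HB Require Import structures.
From mathcomp Require Import all_boot all_order all_fingroup all_algebra.
From mathcomp Require Import all_classical all_reals all_analysis.
From mathcomp Require Import zify ring lra.

Set Implicit Arguments.
Unset Strict Implicit.
Unset Printing Implicit Defensive.

Import Order.TTheory GRing.Theory Num.Theory.
Import numFieldNormedType.Exports.

Local Open Scope classical_set_scope.
Local Open Scope ring_scope.

Local Notation ohead := Defs.ohead.

Local Notation rgraph := Defs.rgraph.

Local Notation within := Defs.within.

(** * The matrix-tree theorem *)

(** From means to laws: composing one isomorphism from [t] to a ball with the automorphisms of [t]
    gives all of them, so their number is [#|automorphisms e o|] or 0, and its mean divided by this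
    constant is a probability. Both laws are computed in this way and compared as closed
    expressions. Bonferroni's inequalities enter because the moments converge for each order
    separately; the error of a truncated alternating sum is at most the next moment, whose limit is
    small.

    The transfer impedance theorem is derived from a weighted matrix-tree theorem. Prescribed edges
    get the weight X + 1 and all others the weight X. A block elimination relates this determinant
    to that of X plus the matrix of impedances, and at X = 0, after cancelling powers of X, only the
    trees containing all prescribed edges remain.

    Copies in a graph are counted by oriented edges, since parallel edges give different copies;
    inside a spanning tree the vertices suffice. Trees are lists of parents, so that a new leaf is a
    cons: this serves both the induction on the number of copies and the leaves added for the
    moments. *)

Lemma det_sum_ffun (K : comNzRingType) (n : nat) (I : finType)
    (A : 'I_n -> I -> K) (B : I -> 'I_n -> K) :
  \det (\matrix_(i, j) \sum_x A i x * B x j) =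
  \sum_(f : {ffun 'I_n -> I})
    (\prod_i A i (f i)) * \det (\matrix_(i, j) B (f i) j).
Proof.
under [RHS]eq_bigr do rewrite big_distrr /=.
rewrite exchange_big /=; apply: eq_bigr => s _.
under eq_bigr do rewrite mxE.
rewrite (bigA_distr_bigA (fun i x => A i x * B x (s i))) big_distrr /=.
apply: eq_bigr => f _; rewrite mulrCA; congr (_ * _).
by rewrite big_split; congr (_ * _); apply: eq_bigr => i _; rewrite mxE.
Qed.

(** Each permutation in the expansion of the first determinant contributes one copy of the left-hand
    determinant: reindexing [f] by it permutes the rows of the second factor, which produces the
    sign. Summing over all maps instead of subsets costs the factorial. *)
Lemma Cauchy_Binet_ffun (K : comNzRingType) (n : nat) (I : finType)
    (A : 'I_n -> I -> K) (B : I -> 'I_n -> K) :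
  n`!%:R * \det (\matrix_(i, j) \sum_x A i x * B x j) =
  \sum_(f : {ffun 'I_n -> I})
    \det (\matrix_(i, j) A i (f j)) * \det (\matrix_(i, j) B (f i) j).
Proof.
rewrite -[in LHS]card_Sn -sum1_card natr_sum big_distrl /=.
under [RHS]eq_bigr do rewrite big_distrl /=.
rewrite exchange_big /=; apply: eq_bigr => s _.
rewrite mul1r det_sum_ffun.
have inj : injective (fun f : {ffun 'I_n -> I} => [ffun i => f (s i)]).
  move=> f g /ffunP fg; apply/ffunP => i.
  by have := fg ((s^-1)%g i); rewrite !ffunE permKV.
rewrite (reindex_inj inj) /=; apply: eq_bigr => f _.
under eq_bigr do rewrite ffunE.
under [in RHS]eq_bigr do rewrite mxE.
have -> : \matrix_(i, j) B ([ffun i0 => f (s i0)] i) j =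
          row_perm s (\matrix_(i, j) B (f i) j).
  by apply/matrixP => i j; rewrite !mxE ffunE.
by rewrite row_permE det_mulmx det_perm mulrCA mulrA.
Qed.

(** * Cycles and bridges in multigraphs *)

Section Cycles.
Context (G : mgraph).
Implicit Types (x y : vertex G) (d : oedge G) (S : {set edge G}) (p : seq (vertex G)).

Definition rev_oedge d : oedge G := (d.1, ~~ d.2).

Lemma otail_rev d : otail (rev_oedge d) = ohead d.
Proof. by case: d => e []. Qed.

Lemma ohead_rev d : ohead (rev_oedge d) = otail d.
Proof. by case: d => e []. Qed.

Lemma oedge_same_edge d d' : d.1 = d'.1 -> d' = d \/ d' = rev_oedge d.
Proof. by case: d d' => e [] [e' []] /= ->; [left|right|right|left]. Qed.

Lemma edge_adjP S x y :
  reflect (exists2 d, d.1 \in S & otail d = x /\ ohead d = y) (edge_adj S x y).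
Proof.
apply: (iffP existsP) => [[d /and3P[dS /eqP dx /eqP dy]]|[d dS [dx dy]]].
  by exists d.
by exists d; rewrite dS dx dy !eqxx.
Qed.

Lemma edge_adj_sym S : symmetric (edge_adj S).
Proof.
suff sym x y : edge_adj S x y -> edge_adj S y x by move=> x y; apply/idP/idP; apply: sym.
case/edge_adjP => d dS [dx dy]; apply/edge_adjP; exists (rev_oedge d) => //.
by rewrite otail_rev ohead_rev.
Qed.

(** An edge used again, in either direction, would bring the path back to a vertex that it has
    already left. *)
Lemma path_oedges S x p : path (edge_adj S) x p -> uniq (x :: p) ->
  exists ds : seq (oedge G), [/\ all (fun d => d.1 \in S) ds,
    map (@ohead G) ds = p, map (@otail G) ds = belast x p & uniq (map fst ds)].
Proof.
elim: p x => [|y p IH] x /=; first by exists [::].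
case/andP => /edge_adjP[d dS [dx dy]] pp /andP[xyp uyp].
have [ds [dsS dsh dst dsu]] := IH y pp uyp.
exists (d :: ds); rewrite /= dS dsS dsh dst dx dy dsu; split => //; rewrite andbT.
apply/mapP => -[d' d'ds /oedge_same_edge dd'].
case/negP: xyp; rewrite -dx in_cons.
case: dd' => dd'; last first.
  apply/orP; right; rewrite -dsh; apply/mapP; exists d' => //.
  by rewrite dd' ohead_rev.
have : otail d \in belast y p by rewrite -dst -dd'; apply: map_f.
by move/mem_belast; rewrite in_cons.
Qed.

Lemma oedge_path d (ds : seq (oedge G)) :
  map (@ohead G) (belast d ds) = map (@otail G) ds ->
  path (fun d d' => ohead d == otail d') d ds.
Proof. by elim: ds d => //= d' ds IH d [-> /IH ->]; rewrite eqxx. Qed.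

Lemma oedges_connect S d (ds : seq (oedge G)) :
  path (fun d d' => ohead d == otail d') d ds -> all (fun d => d.1 \in S) ds ->
  connect (edge_adj S) (ohead d) (ohead (last d ds)).
Proof.
elim: ds d => [|d' ds IH] d /=; first by rewrite connect0.
case/andP => /eqP dd' pds /andP[d'S dsS].
apply: connect_trans (IH d' pds dsS); apply: connect1.
by apply/edge_adjP; exists d'.
Qed.

(** The connecting path may be empty or a single edge, so self-edges and parallel edges are
    covered. *)
Lemma path_cycle S d : d.1 \notin S ->
  connect (edge_adj S) (ohead d) (otail d) -> exists c, is_cycle (d.1 |: S) c.
Proof.
move=> dS /connectP[p0 pp0 lp0]; case/shortenP: pp0 lp0 => p pp up _ lp.
have [ds [dsS dsh dst dsu]] := path_oedges pp up.
exists (d :: ds); rewrite /is_cycle /= finset.setU11 dst lp.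
have -> /= : all (fun d0 => d0.1 \in d.1 |: S) ds.
  by apply: sub_all dsS => d0 d0S; rewrite finset.inE d0S orbT.
apply/and3P; split.
- apply: oedge_path; rewrite belast_rcons /= dsh map_rcons dst lp.
  by rewrite -lastI.
- by move: up; rewrite lastI rcons_uniq.
- rewrite dsu andbT; apply/mapP => -[d' /(allP dsS) d'S dd'].
  by rewrite dd' d'S in dS.
Qed.

Lemma is_cycleS S S' c : S \subset S' -> is_cycle S c -> is_cycle S' c.
Proof.
move=> /fintype.subsetP SS' /and5P[c0 cS cc ct ce]; apply/and5P; split => //.
by apply: sub_all cS => d; apply: SS'.
Qed.

(** This form of acyclicity excludes self-edges, parallel edges and detours in spanning trees. *)
Lemma spanning_tree_bridge S d : spanning_tree S -> d.1 \in S ->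
  ~~ connect (edge_adj (S :\ d.1)) (ohead d) (otail d).
Proof.
move=> [_ acyc] dS; apply/negP => /path_cycle[|c]; first by rewrite !inE eqxx.
by apply/negP; rewrite finset.setD1K.
Qed.

End Cycles.

Section MatrixTree.
Context (G : mgraph) (v : vertex G).
Implicit Types (x y : vertex G) (d : oedge G) (S : {set edge G}).
Local Notation n := #|vertex G|.

Definition incidence (K : pzRingType) d x : K :=
  (x == otail d)%:R - (x == ohead d)%:R.

(* Columns of the incidence matrix of the graph with one additional half-edge,
   [None], at [v]; it makes the Laplacian invertible without deleting the row
   and the column of [v]. *)
Definition grounded_incidence (K : pzRingType) (o : option (edge G)) x : K :=
  if o is Some e then incidence K (e, true) x else (x == v)%:R.

Definition grounded_edges S : {set option (edge G)} :=
  (None |: [set Some e | e in S])%SET.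

Definition selected_edges (f : {ffun 'I_n -> option (edge G)}) : {set edge G} :=
  [set e | Some e \in codom f]%SET.

(** The determinant of [selected_mx] is 1 or -1 for these selections and 0 for all others. *)
Definition grounds (f : {ffun 'I_n -> option (edge G)}) : bool :=
  (None \in codom f) && `[< connected_by (selected_edges f) >].

Definition selected_mx (K : pzRingType) (f : {ffun 'I_n -> option (edge G)}) :
  'M[K]_n := \matrix_(i, j) grounded_incidence K (f i) (enum_val j).

Definition weighted_laplacian (K : pzRingType) (w : option (edge G) -> K) :
  'M[K]_n := \matrix_(i, j) \sum_o
    w o * grounded_incidence K o (enum_val i) * grounded_incidence K o (enum_val j).

Lemma sum_enum_val (K : nmodType) (F : vertex G -> K) :
  \sum_(i < n) F (enum_val i) = \sum_x F x.
Proof. by rewrite -(big_enum_val F). Qed.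

Lemma sum_indicator (K : pzRingType) (F : vertex G -> K) y :
  \sum_x (x == y)%:R * F x = F y.
Proof.
rewrite (bigD1 y) //= eqxx mul1r big1 ?addr0 // => x /negbTE ->.
by rewrite mul0r.
Qed.

Lemma sum_incidence (K : pzRingType) (u : vertex G -> K) d :
  \sum_x incidence K d x * u x = u (otail d) - u (ohead d).
Proof.
rewrite -(sum_indicator u (otail d)) -(sum_indicator u (ohead d)) -sumrB.
by apply: eq_bigr => x _; rewrite mulrBl.
Qed.

Lemma incidence_rev (K : pzRingType) d x :
  incidence K (rev_oedge d) x = - incidence K d x.
Proof. by rewrite /incidence otail_rev ohead_rev opprB. Qed.

Lemma map_selected_mx (K : pzRingType) f :
  map_mx intr (selected_mx int f) = selected_mx K f.
Proof.
apply/matrixP => i j; rewrite !mxE /grounded_incidence.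
by case: (f i) => [e|]; rewrite ?rmorphB /= !natz.
Qed.

Lemma connected_byP S : reflect (forall x, connect (edge_adj S) v x)
  `[< connected_by S >].
Proof.
apply: (iffP (asboolP _)) => [Sc x|Sc x y]; first exact: Sc.
apply: connect_trans (Sc y).
by rewrite (sym_connect_sym (@edge_adj_sym _ S)).
Qed.

Lemma det_kernel (K : comPzRingType) (A : 'M[K]_n) (u : 'cV[K]_n) x :
  A *m u = 0 -> u (enum_rank x) 0 = 1 -> \det A = 0.
Proof.
move=> Au ux; have : \adj A *m (A *m u) = 0 by rewrite Au mulmx0.
rewrite mulmxA mul_adj_mx mul_scalar_mx => /matrixP/(_ (enum_rank x) 0).
by rewrite !mxE ux mulr1.
Qed.

Lemma selected_mulmx (K : comPzRingType) f (u : vertex G -> K) i :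
  (selected_mx K f *m \col_j u (enum_val j)) i 0 =
  if f i is Some e then u (src e) - u (tgt e) else u v.
Proof.
rewrite mxE; under eq_bigr do rewrite !mxE.
rewrite (sum_enum_val (fun x => grounded_incidence K (f i) x * u x)).
by case: (f i) => [e|] /=; rewrite ?sum_incidence ?sum_indicator.
Qed.

(** Explicit kernel vectors: the constant 1 if the half-edge is missing, otherwise the indicator of
    the vertices that the selected edges do not connect to [v]. *)
Lemma det_selected_not_grounds (K : comPzRingType) f :
  ~~ grounds f -> \det (selected_mx K f) = 0.
Proof.
rewrite negb_and => /orP[Nf|].
  pose u : 'cV[K]_n := \col_j (fun _ : vertex G => 1) (enum_val j).
  apply: (@det_kernel _ _ u v); last by rewrite mxE.
  apply/matrixP => i j; rewrite (ord1 j) selected_mulmx mxE.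
  case fi: (f i) => [e|]; first by rewrite subrr.
  by move: Nf; rewrite -fi codom_f.
move=> nc; have [x nx] : exists x, ~~ connect (edge_adj (selected_edges f)) v x.
  apply/existsP; apply: contraNT nc; rewrite negb_exists => /forallP h.
  by apply/connected_byP => x; have := h x; rewrite negbK.
pose u := fun y => (~~ connect (edge_adj (selected_edges f)) v y)%:R : K.
apply: (@det_kernel _ _ (\col_j u (enum_val j)) x); last first.
  by rewrite mxE enum_rankK /u nx.
apply/matrixP => i j; rewrite (ord1 j) selected_mulmx mxE.
case fi: (f i) => [e|]; last by rewrite /u connect0.
have -> : u (src e) = u (tgt e); last by rewrite subrr.
have st : edge_adj (selected_edges f) (src e) (tgt e).
  by apply/edge_adjP; exists (e, true); rewrite // inE -fi codom_f.
rewrite /u; congr (~~ _)%:R; apply/idP/idP => h.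
  by apply: connect_trans h (connect1 _).
by apply: connect_trans h (connect1 _); rewrite edge_adj_sym.
Qed.

(** The rows generate every unit vector over the integers: the half-edge gives the one at [v], and
    each edge of a path from [v] leads on to the next. So there is an integral left inverse, and the
    determinant is a unit. *)
Lemma det_selected_grounds_int f : grounds f ->
  (\det (selected_mx int f)) ^+ 2 = 1.
Proof.
case/andP => Nf /connected_byP cf.
pose P x := exists c : 'rV[int]_n,
  c *m selected_mx int f = \row_j (enum_val j == x)%:R.
have Pall x : P x.
  case/connectP: (cf x) => p; elim/last_ind: p x => [|p y IH] x /=.
    move=> _ ->; case/codomP: Nf => i fi; exists (delta_mx 0 i).
    by rewrite -rowE; apply/rowP => j; rewrite !mxE -fi.
  rewrite rcons_path last_rcons => /andP[pp /edge_adjP[d dS [dt dh]]] ->.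
  have [c cE] := IH _ pp erefl; move: dS; rewrite inE => /codomP[i fi].
  pose s : int := if d.2 then 1 else -1.
  exists (c - s *: delta_mx 0 i); rewrite mulmxBl cE -scalemxAl -rowE.
  apply/rowP => j; rewrite !mxE -fi /= -dt -dh /s /incidence.
  by case: d {fi dt dh s} => e [] /=; rewrite /otail /ohead /= ; ring.
have [C CE] : exists C : 'M[int]_n, C *m selected_mx int f = 1%:M.
  have [c cE] := fin_all_exists Pall.
  exists (\matrix_i c (enum_val i)); apply/row_matrixP => i.
  rewrite row_mul rowK cE; apply/rowP => j; rewrite !mxE (inj_eq enum_val_inj).
  by rewrite eq_sym.
have /(congr1 determinant) := CE; rewrite det_mulmx det1.
move/intUnitRing.unitzPl; rewrite /intUnitRing.unitz => h.
by apply/eqP; rewrite sqrf_eq1; exact: h.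
Qed.

Lemma det_selected_sqr (K : comPzRingType) f :
  (\det (selected_mx K f)) ^+ 2 = (grounds f)%:R.
Proof.
case gf: (grounds f); last by rewrite det_selected_not_grounds ?gf // expr0n.
rewrite -map_selected_mx det_map_mx -rmorphXn /=.
by rewrite det_selected_grounds_int.
Qed.

Lemma grounds_inj f : grounds f -> injective f.
Proof.
move=> gf; apply/injectiveP; apply: contraT => /injectivePn[i [j ij fij]].
have := det_selected_grounds_int gf.
rewrite (determinant_alternate ij); first by rewrite expr0n.
by move=> k; rewrite !mxE fij.
Qed.

Lemma det_weighted_laplacian_ffun (K : comNzRingType) (w : option (edge G) -> K) :
  n`!%:R * \det (weighted_laplacian w) =
  \sum_(f | grounds f) \prod_i w (f i).
Proof.
pose A (i : 'I_n) o : K := w o * grounded_incidence K o (enum_val i).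
pose B o (j : 'I_n) : K := grounded_incidence K o (enum_val j).
rewrite (Cauchy_Binet_ffun A B) [RHS]big_mkcond /=; apply: eq_bigr => f _.
have -> : \matrix_(i, j) A i (f j) = (diag_mx (\row_i w (f i)) *m selected_mx K f)^T.
  by apply/matrixP => i j; rewrite mxE /A mul_diag_mx !mxE.
rewrite det_tr det_mulmx det_diag -mulrA -expr2 det_selected_sqr.
under eq_bigr do rewrite mxE.
by case: ifP => _; rewrite ?mulr1 ?mulr0.
Qed.

(** The quadratic form is the sum of the squared differences along [S] and of the squared value at
    [v]. If it vanishes, the vector is 0 at [v] and constant along the edges of [S]. *)
Lemma weighted_laplacian_neq0 (K : realDomainType) S : connected_by S ->
  \det (weighted_laplacian (fun o => (o \in grounded_edges S)%:R : K)) != 0.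
Proof.
move=> Sc; apply/det0P => -[u u0 uL].
pose q o := \sum_x u 0 (enum_rank x) * grounded_incidence K o x.
have : \sum_o (o \in grounded_edges S)%:R * q o ^+ 2 = 0.
  transitivity
    ((u *m weighted_laplacian (fun o => (o \in grounded_edges S)%:R : K) *m u^T) 0 0);
    last by rewrite uL mul0mx mxE.
  rewrite mxE.
  under [RHS]eq_bigr do rewrite !mxE big_distrl /=.
  under [RHS]eq_bigr do under eq_bigr do rewrite !mxE big_distrr big_distrl /=.
  under [RHS]eq_bigr do rewrite exchange_big /=.
  rewrite [RHS]exchange_big /=; apply: eq_bigr => o _.
  rewrite expr2 {1}/q big_distrl /= big_distrr /=.
  rewrite -sum_enum_val; apply: eq_bigr => i _.
  rewrite /q -(sum_enum_val (fun x => u 0 (enum_rank x) * _)).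
  rewrite !big_distrr /=; apply: eq_bigr => j _.
  by rewrite !enum_valK; ring.
move/psumr_eq0P => q0.
have {}q0 o : o \in grounded_edges S -> q o = 0.
  move=> oS; have /eqP := q0 (fun o _ => mulr_ge0 (ler0n _ _) (sqr_ge0 _)) o isT.
  by rewrite oS mul1r sqrf_eq0 => /eqP.
pose U x := u 0 (enum_rank x).
have qE e : q (Some e) = U (src e) - U (tgt e).
  by rewrite /q; under eq_bigr do rewrite mulrC; rewrite (sum_incidence U (e, true)).
have Uv : U v = 0.
  rewrite -(q0 None) ?inE //.
  by rewrite /q; under [RHS]eq_bigr do rewrite mulrC; rewrite (sum_indicator U).
case/eqP: u0; apply/rowP => i; rewrite mxE -(enum_valK i) -/(U _).
case/connectP: (Sc v (enum_val i)) => p; move: (enum_val i) => x {i}.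
elim/last_ind: p x => [|p y IH] x /=; first by move=> _ ->.
rewrite rcons_path last_rcons => /andP[pp /edge_adjP[d dS [dt dh]]] ->.
have := IH _ pp erefl; rewrite -dt -dh.
have : q (Some d.1) = 0 by rewrite q0 // !inE imset_f.
rewrite qE => /eqP; rewrite subr_eq0 => /eqP.
by rewrite /otail /ohead; case: d.2 => -> // ->.
Qed.

(** A spanning tree inside [S] is found without a search: the determinant weighted by the indicator
    of [S] is nonzero, so some term of its expansion is. *)
Lemma connected_grounds S : connected_by S ->
  exists2 f, grounds f & selected_edges f \subset S.
Proof.
move/(weighted_laplacian_neq0 rat) => L0.
pose w o : rat := (o \in grounded_edges S)%:R.
have : \sum_(f | grounds f) \prod_i w (f i) != 0.
  rewrite -det_weighted_laplacian_ffun; apply: mulf_neq0 L0.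
  by rewrite pnatr_eq0 -lt0n fact_gt0.
move=> sf; have /existsP[f /andP[gf wf]] :
    [exists f, grounds f && (\prod_i w (f i) != 0)].
  apply: contraNT sf; rewrite negb_exists => /forallP h; apply/eqP.
  by apply: big1 => f gf; have := h f; rewrite gf /= negbK => /eqP.
exists f => //; apply/fintype.subsetP => e; rewrite inE => /codomP[i fi].
move: wf; rewrite (bigD1 i) //= -fi mulf_eq0 negb_or => /andP[+ _].
rewrite /w !inE /= pnatr_eq0 eqb0 negbK => /imsetP[e' e'S [->]].
exact: e'S.
Qed.

Lemma codom_grounds f : grounds f ->
  finset.finset (mem (codom f)) = grounded_edges (selected_edges f).
Proof.
case/andP => Nf _; apply/setP => -[e|]; rewrite !inE /=.
  apply/idP/imsetP => [ef|[e' + [->]]]; last by rewrite inE.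
  by exists e; rewrite ?inE.
exact: Nf.
Qed.

Lemma card_grounded_edges S : #|grounded_edges S| = #|S|.+1.
Proof.
rewrite /grounded_edges cardsU1 card_imset; last by move=> ? ? [].
by case: imsetP => // -[].
Qed.

Lemma card_selected_edges f : grounds f -> #|selected_edges f|.+1 = n.
Proof.
move=> gf; rewrite -card_grounded_edges -codom_grounds // cardsE.
by rewrite card_codom ?card_ord //; apply: grounds_inj.
Qed.

Lemma connected_card S : connected_by S -> (n <= #|S|.+1)%N.
Proof.
case/connected_grounds => f gf /subset_leq_card fS.
by rewrite -(card_selected_edges gf) ltnS.
Qed.

Lemma connect_cycle_edge S (c : seq (oedge G)) : is_cycle S c ->
  exists2 d, d.1 \in S & connect (edge_adj (S :\ d.1)) (ohead d) (otail d).
Proof.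
case: c => [//|d ds] /and5P[_ /= /andP[dS dsS] cc _ /andP[dds _]].
exists d => //.
have {dds} : all (fun d' => d'.1 \in (S :\ d.1)%SET) ds.
  apply/allP => d' d'ds; rewrite !inE (allP dsS) // andbT.
  by apply: contraNneq dds => <-; apply: map_f.
by move: cc; rewrite rcons_path => /andP[/oedges_connect h /eqP <-] /h.
Qed.

(** A selection inside [S] connects everything with the right number of edges, so any further edge
    would close a cycle; conversely, deleting an edge of a cycle would leave a connected set with
    too few edges. *)
Lemma spanning_treeP S : spanning_tree S <-> connected_by S /\ #|S|.+1 = n.
Proof.
split=> [[Sc acyc]|[Sc Sn]]; split => //.
  have [f gf fS] := connected_grounds Sc.
  rewrite -(card_selected_edges gf); congr _.+1; apply/eqP.
  rewrite eqn_leq (subset_leq_card fS) andbT; apply: subset_leq_card.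
  apply/fintype.subsetP => e eS; apply: contraT => ef.
  have /andP[_ /asboolP fc] := gf.
  have [|c cyc] := @path_cycle _ (selected_edges f) (e, true) ef; first exact: fc.
  have := acyc c; rewrite (is_cycleS _ cyc) //.
  by apply/fintype.subsetP => e'; rewrite !inE => /predU1P[->//|e'f]; apply: (fintype.subsetP fS); rewrite inE.
move=> c; apply/negP => /connect_cycle_edge[d dS cd].
have : connected_by (S :\ d.1)%SET.
  move=> x y; apply: connect_sub (Sc x y) => a b /edge_adjP[d' d'S [<- <-]].
  have sym := sym_connect_sym (@edge_adj_sym _ (S :\ d.1)%SET).
  have [dd'|dd'] := eqVneq d'.1 d.1; last first.
    by apply: connect1; apply/edge_adjP; exists d'; rewrite // !inE dd'.
  by case: (oedge_same_edge (esym dd')) => ->; rewrite ?otail_rev ?ohead_rev // sym.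
by move/connected_card; rewrite -Sn ltnS (cardsD1 d.1 S) dS ltnn.
Qed.

Lemma grounds_spanning f : grounds f -> selected_edges f \in spanning_trees G.
Proof.
move=> gf; rewrite inE; apply/asboolP/spanning_treeP.
by rewrite card_selected_edges //; case/andP: gf => _ /asboolP.
Qed.

(** Each spanning tree is thus selected by the bijections onto its grounded edges; their number is
    the factorial cancelled in the matrix-tree theorem. *)
Lemma grounds_codom f S : S \in spanning_trees G ->
  grounds f && (selected_edges f == S) =
  (f \in ffun_on (grounded_edges S)) && injectiveb f.
Proof.
rewrite inE => /asboolP/spanning_treeP[Sc Sn]; apply/andP/andP => [[gf /eqP <-]|[/ffun_onP fS /injectiveP fi]].
  split; last exact/injectiveP/grounds_inj.
  by apply/ffun_onP => i; rewrite -codom_grounds // inE; exact: codom_f.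
have fE : finset.finset (mem (codom f)) = grounded_edges S.
  apply/eqP; rewrite eqEcard; apply/andP; split.
    by apply/fintype.subsetP => o; rewrite inE => /codomP[i ->].
  by rewrite card_grounded_edges Sn cardsE card_codom // card_ord.
have fS' : selected_edges f = S.
  apply/setP => e; have /setP/(_ (Some e)) := fE; rewrite !inE /= => ->.
  by rewrite mem_imset //; move=> ? ? [].
rewrite fS' eqxx; split => //; rewrite /grounds fS'; apply/andP; split; last exact/asboolP.
by have /setP/(_ None) := fE; rewrite !inE.
Qed.

Theorem weighted_matrix_tree (K : idomainType) (w : option (edge G) -> K) :
  n`!%:R != 0 :> K ->
  \det (weighted_laplacian w) =
  \sum_(S in spanning_trees G) w None * \prod_(e in S) w (Some e).
Proof.
move=> n0; apply: (mulfI n0); rewrite det_weighted_laplacian_ffun.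
rewrite (partition_big selected_edges (mem (spanning_trees G))) /=; last exact: grounds_spanning.
rewrite big_distrr /=; apply: eq_bigr => S SS.
under eq_bigl do rewrite grounds_codom //.
rewrite (eq_bigr (fun=> w None * \prod_(e in S) w (Some e))); last first.
  move=> f; rewrite -grounds_codom // => /andP[gf /eqP fS].
  transitivity (\prod_(o in grounded_edges S) w o).
    rewrite -fS -codom_grounds //.
    have -> : finset.finset (mem (codom f)) = [set f i | i in predT]%SET.
      by apply/setP => o; rewrite inE; apply/codomP/imsetP => [[i ->]|[i _ ->]]; exists i.
    by rewrite big_imset //= => i j _ _; apply: grounds_inj gf _ _.
  rewrite big_setU1 /=; last by apply/imsetP => -[].
  by rewrite big_imset //= => ? ? _ _ [].
rewrite sumr_const -[X in _ *+ X]/(#|_|).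
rewrite (_ : #|_| = n`!) ?mulr_natl //.
rewrite -(ffactnn n).
have := card_inj_ffuns_on 'I_n (mem (grounded_edges S)).
rewrite card_ord card_grounded_edges.
have -> : #|S|.+1 = n by move: SS; rewrite inE => /asboolP/spanning_treeP[].
by move=> <-; apply: eq_card => f; rewrite !inE.
Qed.

End MatrixTree.

(** * The transfer impedance theorem *)

(** Both sides are ['X^n] times the determinant of [N]: its lower left block is eliminated by means
    of [L] for the left-hand side and of the corner ['X] for the right-hand side. If the columns of
    [B] are incidence columns, the matrix on the right is a Laplacian whose edges in [B] weigh one
    unit more. *)
Lemma det_schur_char (K : fieldType) (n m : nat) (L : 'M[K]_n) (B : 'M[K]_(n, m)) :
  L \in unitmx ->
  'X^n * ((\det L)%:P * \det ('X%:M + map_mx polyC (B^T *m invmx L *m B))) =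
  'X^m * \det ('X *: map_mx polyC L + map_mx polyC (B *m B^T)) :> {poly K}.
Proof.
move=> Lu; pose Lp := map_mx polyC L; pose Bp := map_mx polyC B.
pose N := block_mx Lp Bp (- Bp^T) 'X%:M.
have N1 : N = block_mx 1%:M 0 (- (Bp^T *m map_mx polyC (invmx L))) 1%:M *m
    block_mx Lp Bp 0 ('X%:M + map_mx polyC (B^T *m invmx L *m B)).
  rewrite mulmx_block !mul1mx !mul0mx !addr0 !mulNmx -(mulmxA _ _ Lp).
  by rewrite -map_mxM mulVmx // map_mx1 mulmx1 !map_mxM -map_trmx addrCA addNr addr0.
have N2 : N *m block_mx 'X%:M 0 Bp^T 1%:M =
    block_mx ('X *: Lp + map_mx polyC (B *m B^T)) Bp 0 'X%:M.
  rewrite mulmx_block !mulmx0 !mulmx1 !add0r map_mxM -map_trmx.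
  by rewrite !mul_mx_scalar mul_scalar_mx scalerN addNr.
have := congr1 determinant N2; rewrite det_mulmx N1 det_mulmx.
rewrite det_lblock !det_ublock det_lblock !det1 !det_scalar !mul1r mulr1.
by rewrite /Lp det_map_mx => detN; rewrite mulrC detN mulrC.
Qed.

Lemma sum_option (K : nmodType) (T : finType) (F : option T -> K) :
  \sum_o F o = F None + \sum_x F (Some x).
Proof.
rewrite (bigD1 None) //=; congr (_ + _).
rewrite (reindex_omap (op := +%R) Some id); last by case.
by apply: eq_bigl => x; rewrite /= eqxx.
Qed.

Section TransferImpedance.
Context (R : realType) (G : mgraph) (v : vertex G) (Gc : connected_graph G).
Implicit Types (x y a : vertex G) (d : oedge G) (S : {set edge G}) (u phi : vertex G -> R).
Local Notation n := #|vertex G|.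
Local Notation L := (weighted_laplacian v (fun=> 1 : R)).

Definition incidence_col d : 'cV[R]_n := \col_i incidence R d (enum_val i).

Lemma laplacian_unit : L \in unitmx.
Proof.
rewrite unitmxE unitfE; have := weighted_laplacian_neq0 v R Gc.
congr (\det _ != 0); apply/matrixP => i j; rewrite !mxE; apply: eq_bigr => o _.
suff -> : o \in grounded_edges [set: edge G]%SET by [].
by case: o => [e|]; rewrite !inE ?imset_f ?inE.
Qed.

Lemma laplacian_mulmx u i (a := enum_val i) :
  (L *m \col_j u (enum_val j)) i 0 =
  \sum_(d : oedge G | otail d == a) (u (otail d) - u (ohead d)) + (a == v)%:R * u v.
Proof.
rewrite mxE; under eq_bigr do rewrite !mxE big_distrl /=.
rewrite exchange_big /=.
transitivity (\sum_o grounded_incidence v R o a *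
    \sum_x grounded_incidence v R o x * u x).
  apply: eq_bigr => o _; rewrite -sum_enum_val big_distrr /=.
  by apply: eq_bigr => j _; rewrite mul1r mulrA.
rewrite sum_option sum_indicator addrC; congr (_ + _).
under [LHS]eq_bigr => e _ do rewrite (sum_incidence u (e, true)).
rewrite [RHS]big_mkcond /= -(pair_bigA _ (fun e b => if otail (e, b) == a then
  u (otail (e, b)) - u (ohead (e, b)) else 0)) /=.
apply: eq_bigr => e _; rewrite big_bool /= /incidence /otail /ohead /= !(eq_sym a).
by case: (src e == a); case: (tgt e == a); rewrite ?mulr1n ?mulr0n; ring.
Qed.

(** The half-edge fixes the additive constant: solutions of the grounded system are potentials
    normalised to vanish at [v]. *)
Lemma is_potentialE x y phi : is_potential x y phi <->
  L *m \col_j (phi (enum_val j) - phi v) = \col_i ((enum_val i == x)%:R - (enum_val i == y)%:R).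
Proof.
have E i : (L *m \col_j (phi (enum_val j) - phi v)) i 0 =
    \sum_(d : oedge G | otail d == enum_val i) (phi (otail d) - phi (ohead d)).
  rewrite (laplacian_mulmx (fun a => phi a - phi v)) subrr mulr0 addr0.
  by apply: eq_bigr => d _; ring.
split=> [h|/matrixP h a].
  by apply/matrixP => i j; rewrite (ord1 j) E h mxE.
by have := h (enum_rank a) 0; rewrite E mxE enum_rankK.
Qed.

(** Existence, without which [potential] would be the default value of [xget]. *)
Lemma potentialP x y : is_potential x y (potential x y : vertex G -> R).
Proof.
suff [phi phiP] : exists phi : vertex G -> R, is_potential x y phi.
  exact: (xgetPex (fun=> 0) (ex_intro _ phi phiP)).
pose b : 'cV[R]_n := \col_i ((enum_val i == x)%:R - (enum_val i == y)%:R).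
pose phi a := (invmx L *m b) (enum_rank a) 0.
have phiE : \col_j phi (enum_val j) = invmx L *m b.
  by apply/matrixP => i j; rewrite (ord1 j) mxE /phi enum_valK.
have LphiE i := laplacian_mulmx phi i.
have Lphi : L *m \col_j phi (enum_val j) = b.
  by rewrite phiE mulmxA mulmxV ?mul1mx // laplacian_unit.
(* Summing the equations over all vertices shows that no current leaves through
   the extra half-edge, so that grounding does not change the potential. *)
have phiv : phi v = 0.
  have : \sum_i (L *m \col_j phi (enum_val j)) i 0 = 0.
    rewrite Lphi; under eq_bigr do rewrite mxE.
    rewrite (sum_enum_val (fun a => (a == x)%:R - (a == y)%:R)) sumrB.
    under eq_bigr do rewrite -[_%:R]mulr1.
    under [X in _ - X]eq_bigr do rewrite -[_%:R]mulr1.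
    by rewrite !sum_indicator subrr.
  under eq_bigr do rewrite LphiE.
  rewrite big_split /= (sum_enum_val (fun a => (a == v)%:R * phi v)).
  rewrite (sum_indicator (fun=> phi v)).
  rewrite (sum_enum_val (fun a => \sum_(d : oedge G | otail d == a) (phi (otail d) - phi (ohead d)))).
  have <- : \sum_(d : oedge G) (phi (otail d) - phi (ohead d)) =
      \sum_a \sum_(d : oedge G | otail d == a) (phi (otail d) - phi (ohead d)).
    by rewrite (partition_big (@otail G) xpredT).
  rewrite sumrB.
  rewrite (reindex_inj (h := @rev_oedge G)) /=; last first.
    by apply: (can_inj (g := @rev_oedge G)) => -[e o]; rewrite /rev_oedge negbK.
  under eq_bigr do rewrite otail_rev.
  by rewrite subrr add0r.
exists phi; apply/is_potentialE; rewrite phiv.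
by under eq_mx do rewrite subr0.
Qed.

Lemma transfer_impedanceE d d' : transfer_impedance d d' =
  ((incidence_col d')^T *m invmx L *m incidence_col d) 0 0 :> R.
Proof.
have /is_potentialE := potentialP (otail d) (ohead d).
set phi := potential _ _ => Lphi.
have -> : incidence_col d = L *m \col_j (phi (enum_val j) - phi v).
  by rewrite Lphi; apply/matrixP => i j; rewrite !mxE.
rewrite -mulmxA mulKmx ?laplacian_unit // mxE.
under eq_bigr do rewrite !mxE.
rewrite (sum_enum_val (fun a => incidence R d' a * (phi a - phi v))).
by rewrite sum_incidence /transfer_impedance -/phi; ring.
Qed.

Theorem transfer_impedance_theorem (m : nat) (F : 'I_m -> oedge G) :
  injective (fun i => (F i).1) ->
  #|[set S in spanning_trees G | [forall i, (F i).1 \in S]]%SET|%:R =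
  #|spanning_trees G|%:R *
    \det (\matrix_(i, j) transfer_impedance (F i) (F j)) :> R.
Proof.
move=> Finj; pose B : 'M[R]_(n, m) := \matrix_(i, j) incidence R (F j) (enum_val i).
pose E := [set (F i).1 | i in 'I_m]%SET.
have ME : \matrix_(i, j) transfer_impedance (F i) (F j) = (B^T *m invmx L *m B)^T.
  apply/matrixP => i j; rewrite mxE transfer_impedanceE !mxE.
  apply: eq_bigr => k _; rewrite !mxE; congr (_ * _).
  by apply: eq_bigr => l _; rewrite !mxE.
rewrite ME det_tr.
have cardE : #|E| = m by rewrite card_imset ?card_ord.
pose s S := #|S :&: E|.
have s_n S : S \in spanning_trees G -> (s S <= n)%N.
  rewrite inE => /asboolP/(spanning_treeP v)[_ <-].
  by apply: leq_trans (leqnSn _); apply/subset_leq_card/finset.subsetIl.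
have s_m S : (s S <= m)%N.
  by rewrite -cardE; apply/subset_leq_card/finset.subsetIr.
have factn0 : n`!%:R != 0 :> R by rewrite pnatr_eq0 -lt0n fact_gt0.
have detL : \det L = #|spanning_trees G|%:R.
  rewrite weighted_matrix_tree // -sum1_card natr_sum; apply: eq_bigr => S _.
  by rewrite mul1r big1.
(* With ['X + 1] on the prescribed edges and ['X] elsewhere, half-edge included, the weighted
   Laplacian is ['X] times [L] plus [B *m B^T], and [s S] is the exponent of ['X + 1] in the term of
   [S]. *)
pose w (o : option (edge G)) : {poly R} :=
  'X + (if o is Some e then (e \in E)%:R else 0).
have detw : \det (weighted_laplacian v w) =
    \sum_(S in spanning_trees G) 'X^(n - s S) * ('X + 1) ^+ s S.
  rewrite weighted_matrix_tree; last first.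
    by rewrite -polyC_natr polyC_eq0.
  apply: eq_bigr => S SS.
  rewrite (bigID (mem E)) /=.
  rewrite (eq_bigr (fun=> 'X + 1)); last by move=> e /andP[_ eE]; rewrite /w eE.
  rewrite [X in _ * (_ * X)](eq_bigr (fun=> 'X)); last first.
    by move=> e /andP[_ /negbTE eE]; rewrite /w eE addr0.
  have -> : w None = 'X by rewrite /w addr0.
  rewrite !prodr_const; set p := #|_|; set q := #|_|.
  have -> : s S = p by apply: eq_card => e; rewrite !inE.
  have -> : (n - p = q.+1)%N; last first.
    by rewrite exprS -mulrA; congr (_ * _); rewrite mulrC.
  move: SS; rewrite inE => /asboolP/(spanning_treeP v)[_ <-].
  rewrite -(cardsID E S) -addnS addnC.
  have -> : #|S :&: E| = p by apply: eq_card => e; rewrite !inE.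
  by rewrite addnK; congr _.+1; apply: eq_card => e; rewrite !inE andbC.
have Lw : 'X *: map_mx polyC L + map_mx polyC (B *m B^T) = weighted_laplacian v w.
  have gE o a : grounded_incidence v {poly R} o a = (grounded_incidence v R o a)%:P.
    by case: o => [e|] /=; rewrite /incidence ?polyCB ?polyC_natr.
  apply/matrixP => i j; rewrite !mxE.
  under [RHS]eq_bigr do rewrite !gE -mulrA -polyCM mulrDl.
  rewrite big_split /= -big_distrr /= -rmorph_sum.
  congr ('X * _%:P + _); first by apply: eq_bigr => o _; rewrite mul1r.
  rewrite sum_option /= mul0r add0r.
  transitivity (\sum_(e in E) (incidence R (e, true) (enum_val i) *
      incidence R (e, true) (enum_val j))%:P); last first.
    by rewrite [LHS]big_mkcond /=; apply: eq_bigr => e _; case: ifP; rewrite ?mul1r ?mul0r.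
  rewrite big_imset /=; last by move=> ? ? _ _; apply: Finj.
  rewrite rmorph_sum; apply: eq_bigr => k _; rewrite !mxE; congr (_%:P).
  (* Reversing [F k] changes the sign of both factors. *)
  case: (F k) => e [] //=.
  by have iE := incidence_rev R (e, true); rewrite /rev_oedge /= in iE; rewrite !iE mulrNN.
have := det_schur_char B laplacian_unit.
rewrite Lw detw detL [RHS]big_distrr /=.
under [RHS]eq_bigr => S SS.
  have -> : 'X^m * ('X^(n - s S) * ('X + 1) ^+ s S) =
      'X^n * ('X^(m - s S) * ('X + 1) ^+ s S) :> {poly R}.
    by rewrite !mulrA -!exprD addnBA ?s_n // addnBA ?s_m // addnC.
  over.
rewrite -[RHS]big_distrr /= => /mulfI; rewrite expf_eq0 polyX_eq0 andbF => /(_ isT).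
(* At 0 the power ['X^(m - s S)] leaves only the trees with [s S = m]. *)
move=> /(congr1 (fun p : {poly R} => p.[0])); rewrite hornerM hornerC.
have -> (A : 'M[R]_m) : (\det ('X%:M + map_mx polyC A)).[0] = \det A.
  rewrite -[LHS]/(horner_eval 0 _) -det_map_mx; congr (\det _).
  apply/matrixP => i j; rewrite !mxE /= /horner_eval hornerD hornerC.
  by case: eqP => _; rewrite ?mulr1n ?mulr0n ?hornerX ?horner0 add0r.
move=> ->; rewrite horner_sum -sum1_card natr_sum big_mkcond [RHS]big_mkcond /=.
apply: eq_bigr => S _; rewrite inE; case: (S \in _) => //=.
rewrite hornerM !horner_exp !hornerE expr1n mulr1 expr0n subn_eq0.
suff -> : (m <= s S)%N = [forall i, (F i).1 \in S] by case: ifP.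
rewrite -{1}cardE; apply/idP/forallP => [Ss i|FS].
  have /eqP SE : S :&: E == E by rewrite eqEcard finset.subsetIr.
  have : (F i).1 \in E by apply: (imset_f (fun i => (F i).1)).
  by rewrite -SE inE => /andP[].
by apply/subset_leq_card/fintype.subsetP => e /imsetP[i _ ->]; rewrite inE FS; apply: (imset_f (fun i => (F i).1)).
Qed.

End TransferImpedance.

(** * Rooted trees and isomorphisms of their truncations *)

(* In a graph without such detours every vertex has at most one neighbour that
   is not farther from the root than itself. *)
Definition no_detour (V : finType) (e : rel V) : Prop := forall x y z,
  e x y -> e x z -> connect [rel a b | [&& e a b, a != x & b != x]] y z -> y = z.

(* [par x] is the neighbour of [x] towards the root, [None] at the root. *)
Definition tree_order (T : rgraph) (lev : rcarrier T -> nat)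
    (par : rcarrier T -> option (rcarrier T)) : Prop :=
  [/\ rvert (rroot T), lev (rroot T) = 0%N,
      forall x, rvert x -> (par x = None <-> x = rroot T),
      forall x y, rvert x -> par x = Some y -> rvert y /\ lev x = (lev y).+1
    & forall x y, rvert x -> rvert y -> (radj x y <-> par x = Some y \/ par y = Some x)].

(** * Levels and parents from the absence of detours *)

Section TreeOrder.
Context (V : finType) (e : rel V) (o : V).
Hypothesis (e_sym : symmetric e) (e_irr : irreflexive e).
Hypothesis (e_conn : forall x y, connect e x y) (e_nd : no_detour e).

Lemma ex_walk x : exists k, [exists p : k.-tuple V, path e x p && (last x p == o)].
Proof.
case/connectP: (e_conn x o) => p pp lp; exists (size p).
by apply/existsP; exists (in_tuple p); rewrite pp lp eqxx.
Qed.

Let dist x := ex_minn (ex_walk x).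

Let distP x : exists2 p, path e x p /\ last x p = o & size p = dist x.
Proof.
rewrite /dist; case: ex_minnP => k /existsP[p /andP[pp /eqP lp]] _.
by exists p => //; rewrite size_tuple.
Qed.

Let dist_le x p : path e x p -> last x p = o -> (dist x <= size p)%N.
Proof.
move=> pp lp; rewrite /dist; case: ex_minnP => k _; apply.
by apply/existsP; exists (in_tuple p); rewrite pp lp eqxx.
Qed.

Let geodesic_avoids x y p : (dist y <= dist x)%N -> y != x -> path e y p ->
  last y p = o -> size p = dist y -> x \notin p.
Proof.
move=> yx nyx pp lp sp; apply/negP => /splitPr xp.
case: xp pp lp sp => p1 p2; rewrite cat_path last_cat size_cat /= => /and3P[_ _ pp2] lp2 sp.
have := dist_le pp2 lp2; move: yx; lia.
Qed.

Let avoiding_connect x y p : y != x -> x \notin p -> path e y p ->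
  connect [rel a b | [&& e a b, a != x & b != x]] y (last y p).
Proof.
elim: p y => [|z p IH] y nyx /=; first by rewrite connect0.
rewrite in_cons negb_or eq_sym => /andP[nzx xp] /andP[eyz pp].
by apply: connect_trans (IH z nzx xp pp); apply: connect1; rewrite /= eyz nyx nzx.
Qed.

Let closer_unique x y z : e x y -> e x z ->
  (dist y <= dist x)%N -> (dist z <= dist x)%N -> y = z.
Proof.
have neq a : e x a -> a != x by apply: contraTneq => ->; rewrite e_irr.
move=> exy exz yx zx; apply: (e_nd exy exz).
have [p [pp lp] sp] := distP y; have [q [pq lq] sq] := distP z.
have yo := avoiding_connect (neq _ exy) (geodesic_avoids yx (neq _ exy) pp lp sp) pp.
have zo := avoiding_connect (neq _ exz) (geodesic_avoids zx (neq _ exz) pq lq sq) pq.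
rewrite lp in yo; rewrite lq in zo; apply: connect_trans yo _.
rewrite (sym_connect_sym _) // => a b /=; rewrite e_sym.
by congr (_ && _); rewrite andbC.
Qed.

Let closer_exists x : x != o -> exists2 y, e x y & dist x = (dist y).+1.
Proof.
move=> xo; have [[|y p] [/= pp lp] sp] := distP x; first by rewrite lp eqxx in xo.
case/andP: pp => exy pp; exists y => //; apply/eqP; rewrite eqn_leq.
rewrite -{2}sp /= ltnS (dist_le pp lp) andbT.
have [q [pq lq] sq] := distP y; rewrite -sq.
by apply: (@dist_le x (y :: q)); rewrite //= exy.
Qed.

(** Levels are distances to [o]. Geodesics from two neighbours of [x] that are not farther from [o]
    avoid [x] and end at [o], so the neighbours are equal. Hence parents are unique and no edge
    stays within a level. *)
Lemma finite_tree_order : exists lev par,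
  @tree_order (finite_rgraph e o) lev par.
Proof.
pose par x := [pick y | e x y & dist x == (dist y).+1].
have dist0 : dist o = 0%N by apply/eqP; rewrite -leqn0; apply: (@dist_le o [::]).
have parS x y : par x = Some y -> e x y /\ dist x = (dist y).+1.
  by rewrite /par; case: pickP => // y' /andP[exy /eqP d] [<-].
have par_closer x y : e x y -> (dist y <= dist x)%N -> par x = Some y.
  move=> exy yx; have xo : x != o.
    apply/negP => /eqP xo; move: yx; rewrite xo dist0 leqn0 => /eqP y0.
    have [[|//] [_ /= yo] _] : exists2 p, path e y p /\ last y p = o & size p = 0%N.
      by rewrite -y0; exact: distP.
    by move: exy; rewrite xo yo e_irr.
  have [z exz dz] := closer_exists xo.
  have yz : y = z by apply: (closer_unique exy exz yx); rewrite dz.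
  rewrite /par; case: pickP => [y' /andP[exy' /eqP d]|/(_ z)]; last by rewrite exz dz eqxx.
  by congr Some; apply: (closer_unique exy' exy _ yx); rewrite d.
exists dist, par; split => //=.
- move=> x _; split=> [|->]; last first.
    by rewrite /par; case: pickP => // y /andP[_]; rewrite dist0.
  have [//|xo] := eqVneq x o; have [y exy dy] := closer_exists xo.
  by rewrite (par_closer x y) // dy.
- by move=> x y _ /parS[].
- move=> x y _ _; split=> [exy|[/parS[]|/parS[+ _]]] //; last by rewrite e_sym.
  have [yx|xy] := leqP (dist y) (dist x); first by left; apply: par_closer.
  by right; apply: par_closer; rewrite 1?e_sym // ltnW.
Qed.

End TreeOrder.

(** A detour avoiding [x] would close, with the two edges at [x], a cycle of length at least 3. *)
Lemma is_tree_no_detour (V : finType) (e : rel V) : is_tree e -> no_detour e.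
Proof.
case=> e_sym e_irr _ acyc x y z exy exz /connectP[p0 pp0 zE]; move: exz; rewrite {z}zE.
case/shortenP: pp0 => p pp up _ exz.
case: p => [//|w p] in pp up exz *.
have pe : path e y (w :: p) by apply: sub_path pp => a b /and3P[].
have xp : x \notin y :: w :: p.
  have yx : y != x by apply: contraTneq exy => ->; rewrite e_irr.
  elim: (w :: p) y yx pp {exy up exz pe} => [|b q IH] a ax /=; first by rewrite inE eq_sym ax.
  by case/andP => /and3P[_ _ bx] /(IH b bx) h; rewrite in_cons negb_or eq_sym ax.
suff /acyc : ucycle e (x :: y :: w :: p) by [].
apply/andP; split; last by rewrite cons_uniq xp up.
change (path e x (rcons (y :: w :: p) x)); rewrite rcons_path.
by apply/andP; split; [apply/andP | rewrite e_sym].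
Qed.

Lemma is_tree_order (V : finType) (e : rel V) (o : V) : is_tree e ->
  exists lev par, @tree_order (finite_rgraph e o) lev par.
Proof.
move=> et; have nd := is_tree_no_detour et; case: et => e_sym e_irr e_conn _.
exact: finite_tree_order.
Qed.

Section SpanningTree.
Context (G : mgraph) (S : {set edge G}) (St : spanning_tree S).

Lemma spanning_tree_neq (d : oedge G) : d.1 \in S -> otail d != ohead d.
Proof.
move=> /(spanning_tree_bridge St); apply: contraNneq => ->.
exact: connect0.
Qed.

Lemma spanning_tree_simple (d d' : oedge G) : d.1 \in S -> d'.1 \in S ->
  otail d = otail d' -> ohead d = ohead d' -> d = d'.
Proof.
move=> dS d'S t h; have [/oedge_same_edge[//|dd']|dd'] := eqVneq d'.1 d.1.
  by have := spanning_tree_neq dS; rewrite t dd' ohead_rev eqxx.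
have /negP[] := spanning_tree_bridge St dS; apply: connect1.
by rewrite edge_adj_sym; apply/edge_adjP; exists d'; rewrite // !inE dd'.
Qed.

(** A detour avoiding [x], followed by the edge between [z] and [x], would bypass the edge from [x]
    to [y], which is a bridge. *)
Lemma spanning_tree_no_detour : no_detour (edge_adj S).
Proof.
move=> x y z /edge_adjP[d dS [dx dy]] /edge_adjP[d' d'S [d'x d'z]] yz.
have [dd'|dd'] := eqVneq d'.1 d.1.
  case: (oedge_same_edge dd') => dE; first by rewrite -dy -d'z dE.
  by have := spanning_tree_neq d'S; rewrite d'x -dx dE otail_rev eqxx.
have /negP[] := spanning_tree_bridge St dS; rewrite dx dy.
have yz' : connect (edge_adj (S :\ d.1)%SET) y z.
  apply: connect_sub yz => a b /= /and3P[/edge_adjP[f fS [fa fb]] ax bx].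
  apply: connect1; apply/edge_adjP; exists f => //; rewrite !inE fS andbT.
  apply/negP => /eqP/esym/oedge_same_edge[] fE.
    by move: ax; rewrite -fa fE dx eqxx.
  by move: bx; rewrite -fb fE ohead_rev dx eqxx.
apply: connect_trans yz' _; apply: connect1; rewrite edge_adj_sym.
by apply/edge_adjP; exists d'; rewrite // !inE dd'.
Qed.

Lemma spanning_tree_order (v : vertex G) :
  exists lev par, @tree_order (rooted_subgraph v S) lev par.
Proof.
apply: finite_tree_order; first exact: edge_adj_sym.
- by move=> x; apply/edge_adjP => -[d /spanning_tree_neq/eqP dd [dx dy]]; case: dd; rewrite dx dy.
- by case: St.
- exact: spanning_tree_no_detour.
Qed.

End SpanningTree.

(** A step changes the level by one, and parents lead from [x] to the root in [lev x] steps. Balls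
    are thus described by levels in infinite trees as well. *)
Lemma tree_order_within (T : rgraph) lev par : @tree_order T lev par ->
  forall k x, within T k x <-> rvert x /\ (lev x <= k)%N.
Proof.
case=> rT l0 pN pS adjP k x; split.
  case=> p [vp pp <- sp]; move: k sp vp pp; elim/last_ind: p => [|p y IH] k /=.
    by move=> _ _; rewrite l0.
  rewrite size_rcons last_rcons all_rcons rcons_path => sp /andP[rr /andP[vy vp]] /andP[pp py].
  have [vl ll] := IH _ (leqnn _) (introT andP (conj rr vp)) pp.
  split => //; have /adjP := py; case/(_ vl vy) => h.
    by have [_ h'] := pS _ _ vl h; lia.
  by have [_ h'] := pS _ _ vy h; lia.
case=> vx lx; suff [p [vp pp lp sp]] : exists p, [/\ all (@rvert T) (rroot T :: p),
    path (@radj T) (rroot T) p, last (rroot T) p = x & size p = lev x].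
  by exists p; split => //; rewrite sp.
move: {2}(lev x) (erefl (lev x)) => n; elim: n x vx {lx} => [|n IH] x vx lx.
  exists [::]; rewrite /= rT; split => //.
  case px: (par x) => [y|]; first by have [_] := pS _ _ vx px; rewrite lx.
  by symmetry; apply/pN.
case px: (par x) => [y|]; last by move: lx; rewrite ((pN _ vx).1 px) l0.
have := pS _ _ vx px; rewrite lx => -[vy [/esym ly]].
have [p [vp pp lp sp]] := IH _ vy ly.
exists (rcons p x); rewrite size_rcons last_rcons rcons_path lp pp; split => //.
- by rewrite /= all_rcons vx.
- by apply/adjP => //; right.
- by rewrite sp ly.
Qed.

(** * Isomorphisms onto a ball and automorphisms *)

Section Isomorphism.
Context (V : finType) (e : rel V) (o : V) (r : nat).
Context (levt : V -> nat) (part : V -> option V).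
Hypothesis t_order : @tree_order (finite_rgraph e o) levt part.
Hypothesis t_height : height_le (finite_rgraph e o) r.
Context (T : rgraph) (lev : rcarrier T -> nat) (par : rcarrier T -> option (rcarrier T)).
Hypothesis T_order : tree_order lev par.
Implicit Types (phi : V -> rcarrier T).

Definition trunc_iso phi : Prop :=
  [/\ phi o = rroot T, injective phi,
      forall x, rvert (phi x) /\ (lev (phi x) <= r)%N,
      forall y, rvert y -> (lev y <= r)%N -> exists x, phi x = y
    & forall x y, radj (phi x) (phi y) = e x y].

(** Only parents occur and, at inner vertices, the absence of further children. This can be checked
    both on embeddings and on offspring numbers. *)
Definition local_iso phi : Prop :=
  [/\ injective phi, forall x, rvert (phi x),
      forall x, par (phi x) = omap phi (part x)
    & forall x y, (levt x < r)%N -> rvert y -> par y = Some (phi x) ->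
        exists x', y = phi x'].

Lemma tree_order_height x : (levt x <= r)%N.
Proof. by have /(tree_order_within t_order)[] := t_height (isT : @rvert (finite_rgraph e o) x). Qed.

(** Parents are respected by induction on the level: if the image of the parent [w] of [x] were a
    child of [phi x], then [x] would be the parent of [w]. Conversely levels agree, and the absence
    of further children gives surjectivity level by level. *)
Lemma trunc_isoP phi : trunc_iso phi <-> local_iso phi.
Proof.
have [rT l0 pN pS adjP] := T_order; have [_ l0' pN' pS' adjP'] := t_order.
have part0 : part o = None by apply/pN'.
have levE : (forall x, rvert (phi x)) -> (forall x, par (phi x) = omap phi (part x)) ->
    phi o = rroot T -> forall x, lev (phi x) = levt x.
  move=> vphi pphi phio x; move: {2}(levt x) (erefl (levt x)) => n; elim: n x => [|n IH] x lx.
    case px: (part x) => [y|]; first by have [_] := pS' _ _ isT px; rewrite lx.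
    by rewrite ((pN' _ isT).1 px) phio l0.
  case px: (part x) => [y|]; last by move: lx; rewrite ((pN' _ isT).1 px) l0'.
  have [_ lxy] := pS' _ _ isT px; rewrite lxy -IH; last by lia.
  by have [] := pS _ (phi y) (vphi x); rewrite // pphi px.
split=> [[phio inj vphi surj adjE]|[inj vphi pphi ext]].
  have pphi x : par (phi x) = omap phi (part x).
    move: {2}(levt x) (erefl (levt x)) => n; elim: n x => [|n IH] x lx.
      case px: (part x) => [y|]; first by have [_] := pS' _ _ isT px; rewrite lx.
      by apply/(pN _ (vphi x).1); rewrite ((pN' _ isT).1 px).
    case px: (part x) => [w|]; last by move: lx; rewrite ((pN' _ isT).1 px) l0'.
    have [_ lxw] := pS' _ _ isT px.
    have : radj (phi x) (phi w) by rewrite adjE; apply/adjP' => //; left.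
    case/(adjP _ _ (vphi x).1 (vphi w).1) => // pw.
    have := pw; rewrite IH; last by lia.
    case pw': (part w) => [z|//] /= [/inj zx].
    by have [_] := pS' _ _ isT pw'; rewrite zx; lia.
  split => //; first by move=> x; case: (vphi x).
  move=> x y lx vy py; have [|x' <-] := surj y vy; last by exists x'.
  by have [_ ->] := pS _ _ vy py; rewrite levE // => x'; case: (vphi x').
have phio : phi o = rroot T by apply/(pN _ (vphi o)); rewrite pphi part0.
have {}levE := levE vphi pphi phio.
split => //.
- by move=> x; rewrite levE tree_order_height.
- move=> y vy; move: {2}(lev y) (erefl (lev y)) => n; elim: n y vy => [|n IH] y vy ly yr.
    exists o; case py: (par y) => [z|]; first by have [_] := pS _ _ vy py; rewrite ly.
    by rewrite ((pN _ vy).1 py).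
  case py: (par y) => [z|]; last by move: ly; rewrite ((pN _ vy).1 py) l0.
  have := pS _ _ vy py; rewrite ly => -[vz [/esym lz]].
  have [x xz] : exists x, phi x = z by apply: IH => //; lia.
  have [x' ->] : exists x', y = phi x'; last by exists x'.
  by apply: (ext x) => //; [rewrite -levE xz lz -ly | rewrite py xz].
- have omapE a b : omap phi (part a) = Some (phi b) <-> part a = Some b.
    by case: (part a) => [z|] /=; split => // -[]; [move/inj -> | move=> ->].
  move=> x y; apply/idP/idP => [/adjP|/adjP'].
    by rewrite !pphi !omapE => h; apply/adjP' => //; apply: h.
  by rewrite -!omapE -!pphi => h; apply/adjP => //; apply: h.
Qed.

Lemma trunc_iso_inverse phi : injective phi -> exists2 psi : rcarrier T -> V,
  cancel phi psi & forall y, (exists x, phi x = y) -> phi (psi y) = y.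
Proof.
move=> inj.
have ex y : exists x, (exists x', phi x' = y) -> phi x = y.
  by have [[x xy]|nxy] := pselect (exists x, phi x = y); [exists x | exists o].
have [psi psiP] := boolp.choice ex.
by exists psi => // x; apply: inj; apply: psiP; exists x.
Qed.

Lemma riso_trunc_iso : riso (trunc T r) (finite_rgraph e o) <-> exists phi, trunc_iso phi.
Proof.
have wP := tree_order_within T_order r; split.
  case=> f [[_ finj fsurj] fo fadj].
  have ex x : exists y, within T r y /\ f y = x.
    by have [y /= /asboolP wy fy] := fsurj x isT; exists y.
  have [phi phiP] := boolp.choice ex.
  have rroot_in : within T r (rroot T) by apply/wP; case: T_order => ? ->.
  have vphi x : rvert (phi x : rcarrier (trunc T r)) by apply/asboolP; case: (phiP x).
  have phif y : within T r y -> phi (f y) = y.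
    move=> wy; apply: finj; rewrite ?inE //=; first by apply/asboolP; case: (phiP (f y)).
      exact/asboolP.
    by case: (phiP (f y)).
  exists phi; split.
  - by rewrite -[RHS]phif //; congr phi; rewrite -[LHS]fo.
  - by apply: (can_inj (g := f)) => x; case: (phiP x).
  - by move=> x; apply/wP; case: (phiP x).
  - by move=> y vy ly; exists (f y); apply: phif; apply/wP.
  - move=> x y; have := fadj _ _ (vphi x) (vphi y).
    by case: (phiP x) => _ ->; case: (phiP y) => _ ->.
case=> phi [phio inj vphi surj adjE].
have [psi psiK psiP] := trunc_iso_inverse inj.
have psiE y : within T r y -> phi (psi y) = y.
  by move=> /wP[vy ly]; apply/psiP/surj.
exists psi; split.
- split => // [x y|x _].
    by rewrite !inE /= => /asboolP wx /asboolP wy xy; rewrite -(psiE x) // -(psiE y) // xy.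
  by exists (phi x); rewrite ?psiK //=; apply/asboolP/wP.
- by rewrite /= -phio psiK.
- by move=> x y /asboolP wx /asboolP wy /=; rewrite -adjE !psiE.
Qed.

Definition automorphisms : {set {ffun V -> V}} :=
  [set f : {ffun V -> V} | [&& f o == o, injectiveb f
    & [forall x, forall y, e (f x) (f y) == e x y]]]%SET.

(** Comparison with one fixed isomorphism turns a complete list without repetitions into the list of
    automorphisms. This is applied to embeddings into a spanning tree and to birth orders in the
    limit tree. *)
Lemma card_trunc_iso (I : eqType) (s : seq I) (Phi : I -> V -> rcarrier T) :
  uniq s -> {in s &, forall i j, Phi i =1 Phi j -> i = j} ->
  (forall i, i \in s -> trunc_iso (Phi i)) ->
  (forall phi, trunc_iso phi -> exists2 i, i \in s & Phi i =1 phi) ->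
  size s = (#|automorphisms| * `[< riso (trunc T r) (finite_rgraph e o) >])%N.
Proof.
move=> us inj sI sS; case: asboolP => [/riso_trunc_iso[phi phiI]|nr]; last first.
  rewrite muln0; case: s us inj sI sS => // i s _ _ sI _; case: nr.
  by apply/riso_trunc_iso; exists (Phi i); apply: sI; rewrite mem_head.
rewrite muln1; have [phio pinj vphi surj adjE] := phiI.
have [psi psiK psiP] := trunc_iso_inverse pinj.
pose g i := [ffun x => psi (Phi i x)].
have phig i x : i \in s -> phi (g i x) = Phi i x.
  move=> /sI[_ _ vi _ _]; rewrite ffunE; apply: psiP.
  by case: (vi x) => ? ?; apply: surj.
have gs : uniq (map g s).
  rewrite map_inj_in_uniq // => i j si sj /ffunP gij; apply: inj => // x.
  by rewrite -!phig // gij.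
rewrite -(size_map g) -(card_uniqP gs); apply: eq_card => f.
rewrite [RHS]inE; apply/mapP/and3P => [[i si ->]|[/eqP fo /injectiveP finj fe]].
  have [io iinj vi isurj iadj] := sI _ si; split.
  - by rewrite ffunE io -phio psiK.
  - by apply/injectiveP => x y gxy; apply: iinj; rewrite -!phig // gxy.
  - by apply/forallP => x; apply/forallP => y; rewrite -adjE !phig // iadj.
have [|i si iE] := sS (phi \o f).
  split => /=; first by rewrite fo.
  - by move=> x y /pinj/finj.
  - by move=> x; apply: vphi.
  - move=> y vy ly; have [x xy] := surj y vy ly.
    by exists (invF finj x); rewrite /= f_invF.
  - by move=> x y; rewrite adjE; move/forallP/(_ x)/forallP/(_ y)/eqP: fe.
by exists i => //; apply/ffunP => x; apply: pinj; rewrite phig // iE.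
Qed.

Lemma automorphisms_gt0 : (0 < #|automorphisms|)%N.
Proof.
apply/card_gt0P; exists [ffun x => x]; rewrite inE ffunE eqxx /=; apply/andP; split.
  by apply/injectiveP => x y; rewrite !ffunE.
by apply/forallP => x; apply/forallP => y; rewrite !ffunE.
Qed.

End Isomorphism.

(** * Embeddings of recursive trees *)

(* A recursive tree on the vertices 0, ..., size p: the list [p] holds, last
   vertex first, the parents of the vertices 1, ..., size p. *)
Fixpoint recursive_tree (p : seq nat) : bool :=
  if p is a :: p' then (a <= size p')%N && recursive_tree p' else true.

Lemma recursive_tree_nth_le p i : recursive_tree p -> (i < size p)%N ->
  (nth 0%N (rev p) i <= i)%N.
Proof.
elim: p => //= a p IH /andP[ap pp]; rewrite ltnS leq_eqVlt rev_cons nth_rcons size_rev.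
by case/predU1P => [->|ip]; [rewrite ltnn eqxx | rewrite ip IH].
Qed.

(* The lists of the images of the vertices, again with the last vertex first,
   hence the [rev] in [nth rho (rev hs) a]. *)
Fixpoint tree_embeddings (U : finType) (adj : rel U) (rho : U) (p : seq nat) :
    seq (seq U) :=
  if p is a :: p' then
    [seq y :: hs | hs <- tree_embeddings adj rho p',
                   y <- enum [pred y | adj (nth rho (rev hs) a) y & y \notin hs]]
  else [:: [:: rho]].

(** The possible parents of [j] new leaves: for [g] in this list, [g ++ p] is the tree [p] with
    these leaves added. *)
Fixpoint lists_of (A : seq nat) (j : nat) : seq (seq nat) :=
  if j is j'.+1 then [seq a :: g | g <- lists_of A j', a <- A] else [:: [::]].

Section TreeEmbeddings.
Context (U : finType) (adj : rel U) (rho : U).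
Implicit Types (p g : seq nat) (hs : seq U).
Local Notation emb := (tree_embeddings adj rho).

Lemma mem_tree_embeddings p a y hs :
  (y :: hs \in emb (a :: p)) =
  [&& hs \in emb p, adj (nth rho (rev hs) a) y & y \notin hs].
Proof.
apply/allpairsPdep/and3P => [[hs' [y' [hsE + [-> ->]]]]|[hsE ya yhs]].
  by rewrite mem_enum => /andP[].
by exists hs, y; rewrite mem_enum inE ya yhs.
Qed.

Lemma tree_embeddings_cons p a hs : hs \in emb (a :: p) ->
  exists y hs', hs = y :: hs'.
Proof. by case/allpairsPdep => hs' [y [_ _ ->]]; exists y, hs'. Qed.

Lemma big_tree_embeddings (K : nmodType) p a (F : seq U -> K) :
  \sum_(hs <- emb (a :: p)) F hs =
  \sum_(hs <- emb p) \sum_(y | adj (nth rho (rev hs) a) y && (y \notin hs)) F (y :: hs).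
Proof.
by rewrite big_allpairs_dep /=; apply: eq_bigr => hs _; rewrite big_enum.
Qed.

Lemma tree_embeddings_uniq p : uniq (emb p).
Proof.
elim: p => //= a p IH; apply: allpairs_uniq_dep => //.
  by move=> hs _; apply: enum_uniq.
by move=> [hs y] [hs' y'] _ _ /= [-> ->].
Qed.

Lemma tree_embedding_size p hs : hs \in emb p -> size hs = (size p).+1.
Proof.
elim: p hs => [|a p IH] hs; first by rewrite inE => /eqP ->.
move=> hsp; have [y [hs' E]] := tree_embeddings_cons hsp; move: hsp.
by rewrite E mem_tree_embeddings => /and3P[/IH /= ->].
Qed.

Lemma tree_embedding_uniq p hs : hs \in emb p -> uniq hs.
Proof.
elim: p hs => [|a p IH] hs; first by rewrite inE => /eqP ->.
move=> hsp; have [y [hs' E]] := tree_embeddings_cons hsp; move: hsp.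
by rewrite E mem_tree_embeddings => /and3P[/IH /= -> _ ->].
Qed.

Lemma tree_embedding_root p hs : hs \in emb p -> nth rho (rev hs) 0 = rho.
Proof.
elim: p hs => [|a p IH] hs; first by rewrite inE => /eqP ->.
move=> hsp; have [y [hs' E]] := tree_embeddings_cons hsp; move: hsp.
rewrite E mem_tree_embeddings => /and3P[hsp _ _].
by rewrite rev_cons nth_rcons size_rev (tree_embedding_size hsp) IH.
Qed.

Lemma tree_embedding_drop g p hs : hs \in emb (g ++ p) ->
  drop (size g) hs \in emb p.
Proof.
elim: g hs => [|a g IH] hs; first by rewrite drop0.
move=> hsp; have [y [hs' E]] := tree_embeddings_cons hsp; move: hsp.
by rewrite E mem_tree_embeddings => /and3P[/IH].
Qed.

Context (lev : U -> nat) (par : U -> option U).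
Hypothesis order : @tree_order (finite_rgraph adj rho) lev par.

(** A vertex joins the image next to one already present. It is a child of that vertex, because the
    parent of that vertex is in the image by induction. *)
Lemma tree_embedding_parent_mem p hs x z : recursive_tree p -> hs \in emb p ->
  x \in hs -> par x = Some z -> z \in hs.
Proof.
have [_ _ pN pS adjP] := order.
elim: p hs x z => [|a p IH] hs x z.
  rewrite inE => _ /eqP ->; rewrite inE => /eqP ->.
  by rewrite ((pN rho isT).2 erefl).
case/andP => ap pp hsp; have [y [hs' E]] := tree_embeddings_cons hsp; move: hsp.
rewrite E mem_tree_embeddings => /and3P[hsp ya yhs].
rewrite !in_cons => /predU1P[->|xhs] pxz; last by rewrite (IH hs' x z) // orbT.
have ahs : nth rho (rev hs') a \in hs'.
  by rewrite -mem_rev mem_nth // size_rev (tree_embedding_size hsp).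
have /adjP := ya; case=> // [pay|].
  by rewrite (IH hs' _ y pp hsp ahs pay) in yhs.
by rewrite pxz => -[->]; rewrite ahs orbT.
Qed.

Lemma tree_embedding_neighbour p hs x y : recursive_tree p -> hs \in emb p ->
  x \in hs -> adj x y -> y \notin hs -> par y = Some x.
Proof.
have [_ _ pN pS adjP] := order => pp hsp xhs /adjP[] // pxy.
by rewrite (tree_embedding_parent_mem pp hsp xhs pxy).
Qed.

Lemma tree_embedding_parent p hs i : recursive_tree p -> hs \in emb p ->
  (i < size p)%N ->
  par (nth rho (rev hs) i.+1) = Some (nth rho (rev hs) (nth 0%N (rev p) i)).
Proof.
elim: p hs => [|a p IH] hs //.
case/andP => ap pp hsp; have [y [hs' E]] := tree_embeddings_cons hsp; move: hsp.
rewrite E mem_tree_embeddings => /and3P[hsp ya yhs] /=.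
have sz := tree_embedding_size hsp.
rewrite !rev_cons !nth_rcons !size_rev sz ltnS ltnS leq_eqVlt => /predU1P[->|ip].
  rewrite ltnn !eqxx ltnS ap; apply: (tree_embedding_neighbour pp hsp) => //.
  by rewrite -mem_rev mem_nth // size_rev sz.
rewrite ip IH //.
by have := recursive_tree_nth_le pp ip; case: ltnP => //; lia.
Qed.

Definition outer_neighbours (A : seq nat) hs : pred U :=
  [pred y | (y \notin hs) && has (fun a => adj (nth rho (rev hs) a) y) A].

(** As the last vertex comes first, [take j hs] holds the images of the new leaves and [drop j hs]
    those of the vertices of [p]. *)
Lemma tree_embedding_extension A j g p hs : g \in lists_of A j ->
  all (fun a => (a <= size p)%N) A ->
  hs \in emb (g ++ p) -> size g = j /\ {subset take j hs <= outer_neighbours A (drop j hs)}.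
Proof.
move=> + Ap; elim: j g hs => [|j IH] g hs.
  by rewrite inE => /eqP -> _; split => // x; rewrite take0.
case/allpairsPdep => g' [a [g'A aA ->]] hsp.
have [y [hs' E]] := tree_embeddings_cons hsp; move: hsp.
rewrite E mem_tree_embeddings -/cat => /and3P[hsp ya yhs].
have [sg sub] := IH g' hs' g'A hsp; split; first by rewrite /= sg.
move=> x; rewrite /= in_cons => /predU1P[->|/sub //].
rewrite !inE; apply/andP; split; first by apply: contra yhs; apply: mem_drop.
apply/hasP; exists a => //; move: ya.
rewrite -{1}(cat_take_drop j hs') rev_cat nth_cat size_rev.
have := tree_embedding_drop hsp; rewrite sg => /tree_embedding_size ->.
by rewrite ltnS (allP Ap).
Qed.

(** An outer neighbour is adjacent to only one vertex of the image, its parent, so counting pairs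
    amounts to counting outer neighbours; [j] of them are already occupied. *)
Lemma card_extensions A j g p hs : recursive_tree p -> uniq A ->
  all (fun a => (a <= size p)%N) A -> g \in lists_of A j -> hs \in emb (g ++ p) ->
  (\sum_(a <- A) \sum_(y | adj (nth rho (rev hs) a) y && (y \notin hs)) 1 =
   #|outer_neighbours A (drop j hs)| - j)%N.
Proof.
move=> pp uA Ap gA hsp; have [sg sub] := tree_embedding_extension gA Ap hsp.
have hs0p := tree_embedding_drop hsp; rewrite sg in hs0p.
have sz := tree_embedding_size hs0p.
have uhs := tree_embedding_uniq hsp.
have nthE a : a \in A -> nth rho (rev hs) a = nth rho (rev (drop j hs)) a.
  move=> aA; rewrite -{1}(cat_take_drop j hs) rev_cat nth_cat size_rev sz.
  by rewrite ltnS (allP Ap).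
have cntE y : y \notin drop j hs ->
    (\sum_(a <- A) adj (nth rho (rev (drop j hs)) a) y =
     has (fun a => adj (nth rho (rev (drop j hs)) a) y) A)%N.
  move=> yhs; case: hasP => [[a aA ya]|nA]; last first.
    rewrite big_seq big1 // => a aA; apply/eqP; rewrite eqb0; apply/negP => ya.
    by case: nA; exists a.
  rewrite (bigD1_seq a) //= ya big_seq_cond big1 ?addn0 // => b /andP[bA ba].
  apply/eqP; rewrite eqb0; apply: contra ba => yb; apply/eqP.
  have mem c : c \in A -> nth rho (rev (drop j hs)) c \in drop j hs.
    by move=> cA; rewrite -mem_rev mem_nth // size_rev sz ltnS (allP Ap).
  have pa := tree_embedding_neighbour pp hs0p (mem a aA) ya yhs.
  have := tree_embedding_neighbour pp hs0p (mem b bA) yb yhs.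
  rewrite pa => -[/eqP]; rewrite nth_uniq ?size_rev ?sz ?ltnS ?(allP Ap) //.
    by move/eqP.
  by rewrite rev_uniq (tree_embedding_uniq hs0p).
transitivity (\sum_(y | y \notin hs) \sum_(a <- A) adj (nth rho (rev (drop j hs)) a) y)%N.
  rewrite exchange_big /= big_seq [RHS]big_seq; apply: eq_bigr => a aA.
  rewrite big_mkcond [RHS]big_mkcond /=; apply: eq_bigr => y _.
  by rewrite nthE //; case: (y \notin hs); case: (adj _ _).
have subhs y : y \notin hs -> y \notin drop j hs by apply: contra; apply: mem_drop.
rewrite (eq_bigr (fun y => has (fun a => adj (nth rho (rev (drop j hs)) a) y) A : nat)); last first.
  by move=> y yhs; rewrite cntE // subhs.
rewrite -(cardID (mem (take j hs)) (outer_neighbours A (drop j hs))).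
have -> : #|[predI outer_neighbours A (drop j hs) & take j hs]| = j.
  transitivity #|take j hs|.
    by apply: eq_card => y; rewrite inE /= andbC; apply: andb_idr => /sub.
  rewrite (card_uniqP _); last exact: take_uniq.
  rewrite size_take; case: ltnP => // szj; apply/eqP; rewrite eqn_leq szj.
  by move: (tree_embedding_size hsp); rewrite size_cat sg; lia.
rewrite addKn -sum1_card big_mkcond [RHS]big_mkcond /=; apply: eq_bigr => y _.
rewrite !inE -{1}(cat_take_drop j hs) mem_cat negb_or.
by case: (y \in take j hs); case: (y \in drop j hs); case: (has _ _).
Qed.

(** The falling factorial chooses the images of the leaves one after another. Factorial moments of
    the number of outer neighbours thereby become counts of embeddings. *)
Lemma sum_extensions A j p (F : seq U -> nat) : recursive_tree p -> uniq A ->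
  all (fun a => (a <= size p)%N) A ->
  (\sum_(g <- lists_of A j) \sum_(hs <- emb (g ++ p)) F (drop j hs) =
   \sum_(hs <- emb p) F hs * #|outer_neighbours A hs| ^_ j)%N.
Proof.
move=> pp uA Ap; elim: j F => [|j IH] F.
  by rewrite /= big_seq1; apply: eq_bigr => hs _; rewrite drop0 ffactn0 muln1.
rewrite /= big_allpairs_dep /=.
transitivity (\sum_(g <- lists_of A j) \sum_(hs <- emb (g ++ p))
    F (drop j hs) * (#|outer_neighbours A (drop j hs)| - j))%N; last first.
  rewrite (IH (fun hs => F hs * (#|outer_neighbours A hs| - j))%N).
  by apply: eq_bigr => hs _; rewrite ffactnSr mulnAC mulnA.
rewrite big_seq [RHS]big_seq; apply: eq_bigr => g gA.
under eq_bigr do rewrite big_tree_embeddings.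
rewrite exchange_big /= big_seq [RHS]big_seq; apply: eq_bigr => hs hsp.
rewrite -(card_extensions pp uA Ap gA hsp) big_distrr /=; apply: eq_bigr => a _.
by rewrite big_distrr /=; apply: eq_bigr => y _; rewrite muln1.
Qed.

End TreeEmbeddings.

Lemma tree_embedding_root_mem (U : finType) (adj : rel U) rho p hs :
  hs \in tree_embeddings adj rho p -> rho \in hs.
Proof.
move=> hsp; rewrite -{1}(tree_embedding_root hsp) -mem_rev mem_nth //.
by rewrite size_rev (tree_embedding_size hsp).
Qed.

Lemma ex_tree_enumeration (V : finType) (e : rel V) (o : V) levt part :
  @tree_order (finite_rgraph e o) levt part -> exists p L,
  [/\ recursive_tree p, L \in tree_embeddings e o p & forall x, x \in L].
Proof.
case=> _ _ pN pS adjP.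
have ex k : (k < #|V|)%N -> exists p L,
    [/\ recursive_tree p, L \in tree_embeddings e o p & size p = k].
  elim: k => [|k IH] kV; first by exists [::], [:: o]; rewrite inE.
  have [p [L [pp Lp sp]]] := IH (ltnW kV).
  have [x0 x0L] : exists x, x \notin L.
    apply/existsP; rewrite -negb_forall; apply/negP => /forallP allL.
    suff : (#|V| <= size L)%N by rewrite (tree_embedding_size Lp) sp leqNgt kV.
    rewrite -(card_uniqP (tree_embedding_uniq Lp)); apply: subset_leq_card.
    by apply/fintype.subsetP => x _; apply: allL.
  (* The parent of a missing vertex of minimal level is already in the list. *)
  case: (@arg_minnP _ x0 (fun x => x \notin L) levt x0L) => x xL xmin.
  case px: (part x) => [z|]; last first.
    by rewrite ((pN x isT).1 px) (tree_embedding_root_mem Lp) in xL.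
  have zL : z \in L.
    apply: contraT => /xmin; have [_ ->] := pS _ _ isT px; by rewrite ltnn.
  exists (index z (rev L) :: p), (x :: L); rewrite mem_tree_embeddings Lp xL.
  rewrite nth_index ?mem_rev //=; split; last by rewrite sp.
    rewrite pp andbT -ltnS -(tree_embedding_size Lp) -(size_rev L).
    by rewrite index_mem mem_rev.
  by rewrite andbT; apply/adjP => //; right.
have [|p [L [pp Lp sp]]] := ex #|V|.-1; first by rewrite prednK //; apply/card_gt0P; exists o.
exists p, L; split => // x; suff /eqP/setP/(_ x) : [set y in L]%SET == [set: V]%SET.
  by rewrite !inE.
rewrite eqEcard finset.subsetT cardsT cardsE (card_uniqP (tree_embedding_uniq Lp)).
by rewrite (tree_embedding_size Lp) sp leqSpred.
Qed.

Lemma tree_embeddings_map (V U : finType) (e : rel V) (adj : rel U) o rho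
    (phi : V -> U) p L :
  phi o = rho -> injective phi -> (forall x y, adj (phi x) (phi y) = e x y) ->
  recursive_tree p -> L \in tree_embeddings e o p ->
  map phi L \in tree_embeddings adj rho p.
Proof.
move=> phio inj adjE; elim: p L => [|a p IH] L.
  by rewrite !inE => _ /eqP ->; rewrite /= phio.
move=> /andP[ap pp] Lp; have [y [L' E]] := tree_embeddings_cons Lp; move: Lp.
rewrite E mem_tree_embeddings => /and3P[L'p ya yL'].
rewrite /= mem_tree_embeddings IH //= mem_map // yL' andbT -map_rev.
by rewrite (nth_map o) ?adjE // size_rev (tree_embedding_size L'p).
Qed.

(** * Embeddings that fill a ball *)

Section CountIsomorphisms.
Context (V : finType) (e : rel V) (o : V) (r : nat).
Context (levt : V -> nat) (part : V -> option V).
Hypothesis t_order : @tree_order (finite_rgraph e o) levt part.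
Hypothesis t_height : height_le (finite_rgraph e o) r.
Context (p : seq nat) (L : seq V).
Hypothesis (p_rec : recursive_tree p) (Lp : L \in tree_embeddings e o p).
Hypothesis Lall : forall x, x \in L.
Context (U : finType) (adj : rel U) (rho : U).
Context (lev : U -> nat) (par : U -> option U).
Hypothesis order : @tree_order (finite_rgraph adj rho) lev par.

Definition inner_indices : seq nat :=
  [seq i <- iota 0 (size L) | (levt (nth o (rev L) i) < r)%N].

Lemma inner_indices_le : all (fun a => (a <= size p)%N) inner_indices.
Proof.
apply/allP => a; rewrite mem_filter mem_iota add0n => /and3P[_ _].
by rewrite (tree_embedding_size Lp).
Qed.

Lemma size_inner_indices : size inner_indices = #|[pred x | levt x < r]%N|.
Proof.
rewrite size_filter -(count_map (nth o (rev L)) (fun x => (levt x < r)%N)).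
rewrite -(size_rev L) -/(mkseq _ _) mkseq_nth count_rev -size_filter.
rewrite -(card_uniqP _); last by rewrite filter_uniq // (tree_embedding_uniq Lp).
by apply: eq_card => x; rewrite mem_filter Lall andbT.
Qed.

Let vert hs x := nth rho (rev hs) (index x (rev L)).

Lemma embedding_trunc_iso hs : hs \in tree_embeddings adj rho p ->
  #|outer_neighbours adj rho inner_indices hs| = 0%N ->
  @trunc_iso V e o r (finite_rgraph adj rho) lev (vert hs).
Proof.
move=> hsp /card0_eq N0; have [_ _ pN pS adjP] := order; have [_ _ pN' _ _] := t_order.
have sL := tree_embedding_size Lp; have sh := tree_embedding_size hsp.
have uL : uniq (rev L) by rewrite rev_uniq (tree_embedding_uniq Lp).
have uh : uniq (rev hs) by rewrite rev_uniq (tree_embedding_uniq hsp).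
have indL x : (index x (rev L) < size (rev hs))%N.
  by rewrite size_rev sh -sL -size_rev index_mem mem_rev.
apply/(trunc_isoP t_order t_height order); split => //.
- move=> x y /eqP; rewrite /vert nth_uniq // => /eqP.
  by apply: (index_inj o); rewrite mem_rev.
- move=> x; rewrite /vert; have := indL x; rewrite size_rev sh.
  rewrite -[in RHS](nth_index o (_ : x \in rev L)) ?mem_rev //.
  case: (index x (rev L)) => [|i] ip.
    rewrite (tree_embedding_root hsp) (tree_embedding_root Lp).
    by rewrite ((pN rho isT).2 erefl) ((pN' o isT).2 erefl).
  rewrite (tree_embedding_parent order p_rec hsp ip).
  rewrite (tree_embedding_parent t_order p_rec Lp ip) /=.
  rewrite /vert index_uniq // size_rev sL ltnS.
  by apply: leq_trans (recursive_tree_nth_le p_rec ip) (ltnW ip).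
- move=> x y xr _ py; have ya : adj (vert hs x) y by apply/adjP => //; right.
  have yhs : y \in rev hs.
    have := N0 y; rewrite !inE mem_rev => /negbT; rewrite negb_and negbK => /orP[//|].
    case/hasP; exists (index x (rev L)) => //.
    rewrite mem_filter mem_iota nth_index ?mem_rev // xr /= add0n.
    by rewrite -size_rev index_mem mem_rev.
  exists (nth o (rev L) (index y (rev hs))).
  rewrite /vert index_uniq ?nth_index //.
  by rewrite size_rev sL -sh -size_rev index_mem.
Qed.

Lemma trunc_iso_embedding phi : @trunc_iso V e o r (finite_rgraph adj rho) lev phi ->
  [/\ map phi L \in tree_embeddings adj rho p,
      #|outer_neighbours adj rho inner_indices (map phi L)| = 0%N
    & vert (map phi L) =1 phi].
Proof.
move=> phiI; have [phio inj _ _ adjE] := phiI.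
have /(trunc_isoP t_order t_height order)[_ _ pphi ext] := phiI.
have [_ _ pN pS adjP] := order.
have sL := tree_embedding_size Lp.
have nthE i : (i <= size p)%N -> nth rho (rev (map phi L)) i = phi (nth o (rev L) i).
  by move=> ip; rewrite -map_rev (nth_map o) // size_rev sL.
split.
- exact: tree_embeddings_map phio inj adjE p_rec Lp.
- apply: eq_card0 => y; rewrite !inE; apply/negP => /andP[yL /hasP[a]].
  rewrite mem_filter mem_iota add0n sL ltnS => /and3P[ar _ ap]; rewrite nthE //.
  case/adjP => // [|py]; last first.
    have [x' yx'] := ext _ _ ar isT py.
    by rewrite yx' map_f in yL.
  rewrite pphi; case: (part _) => [z|//] [zy].
  by rewrite -zy map_f in yL.
- move=> x; rewrite /vert nthE ?nth_index ?mem_rev //.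
  by rewrite -ltnS -sL -size_rev index_mem mem_rev.
Qed.

Lemma card_embedding_isos :
  count (fun hs => #|outer_neighbours adj rho inner_indices hs| == 0%N)
    (tree_embeddings adj rho p) =
  (#|automorphisms e o| *
    `[< riso (trunc (finite_rgraph adj rho) r) (finite_rgraph e o) >])%N.
Proof.
rewrite -size_filter.
apply: (card_trunc_iso order (Phi := vert)).
- by rewrite filter_uniq // tree_embeddings_uniq.
- move=> hs hs'; rewrite !mem_filter => /andP[_ hsp] /andP[_ hsp'] E.
  have sh := tree_embedding_size hsp; have sh' := tree_embedding_size hsp'.
  apply: (can_inj (@revK U)); apply: (@eq_from_nth _ rho); first by rewrite !size_rev sh sh'.
  move=> i; rewrite size_rev sh => ip.
  have := E (nth o (rev L) i); rewrite /vert index_uniq //.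
    by rewrite size_rev (tree_embedding_size Lp).
  by rewrite rev_uniq (tree_embedding_uniq Lp).
- by move=> hs; rewrite mem_filter => /andP[/eqP N0 hsp]; apply: embedding_trunc_iso.
- move=> phi /trunc_iso_embedding[hsp N0 E]; exists (map phi L) => //.
  by rewrite mem_filter N0 eqxx.
Qed.

End CountIsomorphisms.

(** * Mean numbers of tree embeddings *)

(** The parent of vertex [i.+1]: the root has no entry, which shifts positions by one. *)
Definition tree_parent (p : seq nat) (i : nat) : nat := nth 0%N (rev p) i.

Lemma tree_parent_cons a p i :
  tree_parent (a :: p) i = if (i < size p)%N then tree_parent p i
                           else if i == size p then a else 0%N.
Proof. by rewrite /tree_parent rev_cons nth_rcons size_rev. Qed.

Lemma tree_colouring p : recursive_tree p -> exists col : nat -> bool,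
  forall i, (i < size p)%N -> col i.+1 = ~~ col (tree_parent p i).
Proof.
elim: p => [|a p IH]; first by exists xpredT.
case/andP => ap /[dup] pp /IH[col colP].
exists (fun i => if i == (size p).+1 then ~~ col a else col i) => i.
rewrite /= ltnS leq_eqVlt tree_parent_cons eqSS => /predU1P[->|ip].
  by rewrite ltnn !eqxx; have /negbTE -> : a != (size p).+1 by lia.
have := recursive_tree_nth_le pp ip; rewrite -/(tree_parent p i) ip => pi.
have /negbTE -> : tree_parent p i != (size p).+1 by lia.
by rewrite colP // (negbTE (_ : i != size p)) //; lia.
Qed.

Section TreeGram.
Context (K : numFieldType) (p : seq nat).
Hypothesis p_rec : recursive_tree p.
Local Notation m := (size p).

Definition tree_edge (i : 'I_m) : {set 'I_m.+1} :=
  [set inord (tree_parent p i); lift ord0 i]%SET.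

Definition tree_incidence : 'M[K]_(1 + m, m) := \matrix_(k, i) (k \in tree_edge i)%:R.

(** The signs [s] of the 2-colouring are orthogonal to the columns of the incidence matrix.
    Adjoining them as a column gives a square [D] with determinant [m.+1], whose Gram determinant is
    [m.+1] times the one sought. *)
Lemma det_tree_gram :
  \det (\matrix_(i, j) #|tree_edge i :&: tree_edge j|%:R : 'M[K]_m) = m.+1%:R.
Proof.
have [col colP] := tree_colouring p_rec.
have inordE (i : 'I_m) : (inord (tree_parent p i) : 'I_m.+1) = tree_parent p i :> nat.
  by rewrite inordK // ltnS (leq_trans (recursive_tree_nth_le p_rec (ltn_ord i))) // ltnW.
pose sgm (k : 'I_(1 + m)) : K := (-1) ^+ (col k (+) col 0%N).
pose s : 'rV[K]_(1 + m) := \row_k sgm k.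
have gram : tree_incidence^T *m tree_incidence =
    \matrix_(i, j) #|tree_edge i :&: tree_edge j|%:R.
  apply/matrixP => i j; rewrite !mxE -sum1_card natr_sum [RHS]big_mkcond /=.
  apply: eq_bigr => k _; rewrite !mxE finset.in_setI.
  by case: (k \in tree_edge i); case: (k \in tree_edge j); rewrite ?mulr1 ?mul0r ?mulr0.
have sC : s *m tree_incidence = 0.
  apply/rowP => i; rewrite !mxE.
  have ne : inord (tree_parent p i) != lift ord0 i.
    rewrite -val_eqE /= inordE; have := recursive_tree_nth_le p_rec (ltn_ord i).
    by rewrite -/(tree_parent p i) /bump; lia.
  transitivity (\sum_(k in tree_edge i) sgm k).
    rewrite [RHS]big_mkcond /=; apply: eq_bigr => k _; rewrite !mxE.
    by case: (k \in _); rewrite ?mulr1 ?mulr0.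
  rewrite big_setU1 ?inE //= big_set1 /sgm inordE /= /bump /= add1n colP //.
  by case: (col _); case: (col 0%N); rewrite /= ?expr0 ?expr1; ring.
have ss : s *m s^T = (m.+1%:R)%:M.
  apply/matrixP => i j; rewrite (ord1 i) (ord1 j) !mxE eqxx mulr1n.
  rewrite (eq_bigr (fun=> 1)) => [|k _]; first by rewrite sumr_const card_ord.
  by rewrite !mxE /sgm -expr2 sqrr_sign.
pose D : 'M[K]_(1 + m) := row_mx s^T tree_incidence.
have D2 : D^T *m D = block_mx (m.+1%:R)%:M 0 0 (tree_incidence^T *m tree_incidence).
  rewrite tr_row_mx mul_col_row trmxK ss sC.
  by rewrite -[tree_incidence^T *m s^T]trmxK trmx_mul !trmxK sC trmx0.
(* Unitriangular, since the root has sign 1. In [Q *m D] the first row is [m.+1] followed by zeros,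
   and the remaining block is triangular with ones on the diagonal. *)
pose Q : 'M[K]_(1 + m) := col_mx s (row_mx 0 1%:M).
have detQ : \det Q = 1.
  rewrite /Q -(hsubmxK s) -/(block_mx _ _ _ _) det_ublock det1 mulr1.
  have -> : lsubmx s = 1%:M.
    by apply/matrixP => i j; rewrite (ord1 i) (ord1 j) !mxE /sgm /= addbb.
  by rewrite det1.
have detD : \det D = m.+1%:R.
  transitivity (\det (Q *m D)); first by rewrite det_mulmx detQ mul1r.
  rewrite /Q /D mul_col_row ss sC.
  rewrite (_ : row_mx 0 1%:M *m tree_incidence = dsubmx tree_incidence); last first.
    by rewrite -{1}(vsubmxK tree_incidence) mul_row_col mul0mx mul1mx add0r.
  rewrite det_lblock det_scalar1 -det_tr det_trig ?big1 ?mulr1 // => [i _|].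
    rewrite !mxE !inE -val_eqE /= inordE.
    have := recursive_tree_nth_le p_rec (ltn_ord i).
    rewrite -/(tree_parent p i) => pi; rewrite -[X in _ || X]val_eqE /= eqxx orbT //.
  apply/is_trig_mxP => i j ij; rewrite !mxE !inE -!val_eqE /= inordE.
  have := recursive_tree_nth_le p_rec (ltn_ord i); rewrite -/(tree_parent p i) => pi.
  by rewrite /bump /=; case: eqP => [|_]; [lia|case: eqP => //; lia].
have := congr1 determinant D2.
rewrite det_mulmx det_tr detD det_ublock det_scalar1 gram => /mulfI -> //.
Qed.

End TreeGram.

Section EdgeEmbeddings.
Context (G : mgraph) (v : vertex G).
Implicit Types (p : seq nat) (ds : seq (oedge G)) (S : {set edge G}).

Definition heads ds : seq (vertex G) := rcons (map (@ohead G) ds) v.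

Fixpoint edge_embeddings p : seq (seq (oedge G)) :=
  if p is a :: p' then
    [seq d :: ds | ds <- edge_embeddings p',
       d <- enum [pred d : oedge G | otail d == nth v (rev (heads ds)) a
                                   & ohead d \notin heads ds]]
  else [:: [::]].

Lemma mem_edge_embeddings p a d ds :
  (d :: ds \in edge_embeddings (a :: p)) =
  [&& ds \in edge_embeddings p, otail d == nth v (rev (heads ds)) a
    & ohead d \notin heads ds].
Proof.
apply/allpairsPdep/and3P => [[ds' [d' [dsE + [-> ->]]]]|[dsE da dds]].
  by rewrite mem_enum => /andP[].
by exists ds, d; rewrite mem_enum inE da dds.
Qed.

Lemma edge_embeddings_cons p a ds : ds \in edge_embeddings (a :: p) ->
  exists d ds', ds = d :: ds'.
Proof. by case/allpairsPdep => ds' [d [_ _ ->]]; exists d, ds'. Qed.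

Lemma big_edge_embeddings (K : nmodType) p a (F : seq (oedge G) -> K) :
  \sum_(ds <- edge_embeddings (a :: p)) F ds =
  \sum_(ds <- edge_embeddings p)
    \sum_(d : oedge G | (otail d == nth v (rev (heads ds)) a) && (ohead d \notin heads ds))
      F (d :: ds).
Proof.
by rewrite big_allpairs_dep /=; apply: eq_bigr => ds _; rewrite big_enum.
Qed.

Lemma edge_embedding_size p ds : ds \in edge_embeddings p -> size ds = size p.
Proof.
elim: p ds => [|a p IH] ds; first by rewrite inE => /eqP ->.
move=> dsp; have [d [ds' E]] := edge_embeddings_cons dsp; move: dsp.
by rewrite E mem_edge_embeddings => /and3P[/IH /= ->].
Qed.

Lemma edge_embedding_uniq p ds : ds \in edge_embeddings p -> uniq (heads ds).
Proof.
elim: p ds => [|a p IH] ds; first by rewrite inE => /eqP ->.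
move=> dsp; have [d [ds' E]] := edge_embeddings_cons dsp; move: dsp.
by rewrite E mem_edge_embeddings => /and3P[/IH uh _ dh]; rewrite /heads /= -/(heads _) dh.
Qed.

Lemma edge_embedding_nth p ds d0 i : recursive_tree p -> ds \in edge_embeddings p ->
  (i < size p)%N ->
  otail (nth d0 (rev ds) i) = nth v (rev (heads ds)) (tree_parent p i) /\
  ohead (nth d0 (rev ds) i) = nth v (rev (heads ds)) i.+1.
Proof.
elim: p ds => [|a p IH] ds //.
case/andP => ap pp dsp; have [d [ds' E]] := edge_embeddings_cons dsp; move: dsp.
rewrite E mem_edge_embeddings => /and3P[dsp /eqP da dh] /=.
have sz := edge_embedding_size dsp.
have sh : size (heads ds') = (size p).+1 by rewrite size_rcons size_map sz.
rewrite -[heads (d :: ds')]/(ohead d :: heads ds') !rev_cons !nth_rcons !size_rev sz sh tree_parent_cons.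
move=> ip0; have /predU1P[->|ip] : (i == size p) || (i < size p)%N by rewrite -leq_eqVlt -ltnS.
  by rewrite !ltnn !eqxx ltnS ap da.
rewrite !ltnS ip; have [-> ->] := IH ds' pp dsp ip; split => //.
have := recursive_tree_nth_le pp ip; rewrite -/(tree_parent p i) => pi.
by have -> : (tree_parent p i <= size p)%N by lia.
Qed.

(** A spanning tree has no parallel edges, so the heads determine the oriented edges. *)
Lemma sum_edge_embeddings (K : nmodType) S p (F : seq (vertex G) -> K) :
  spanning_tree S ->
  \sum_(ds <- edge_embeddings p | all (fun d => d.1 \in S) ds) F (heads ds) =
  \sum_(hs <- tree_embeddings (edge_adj S) v p) F hs.
Proof.
move=> St; elim: p F => [|a p IH] F; first by rewrite /= big_cons big_nil big_seq1 addr0.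
rewrite big_mkcond big_edge_embeddings big_tree_embeddings -IH [RHS]big_mkcond.
apply: eq_bigr => ds _; rewrite /=; case: ifP => dsS; last first.
  by apply: big1 => d _; rewrite andbF.
under eq_bigr do rewrite andbT.
rewrite -big_mkcondr /=; set x := nth _ _ _.
rewrite (partition_big (@ohead G) (fun y => edge_adj S x y && (y \notin heads ds))) /=; last first.
  move=> d /andP[/andP[/eqP dx dh] dS]; rewrite dh andbT.
  by apply/edge_adjP; exists d.
apply: eq_bigr => y /andP[/edge_adjP[d dS [dx dy]] yh].
rewrite (big_pred1 d) => [|d']; first by rewrite /heads /= dy.
apply/andP/eqP => [[/andP[/andP[/eqP d'x d'h] d'S] /eqP d'y]|->].
  by apply: (spanning_tree_simple St) => //; rewrite ?d'x ?d'y.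
by rewrite dx dy dS yh !eqxx.
Qed.

Lemma sum_card_tree_embeddings p :
  (\sum_(S in spanning_trees G) size (tree_embeddings (edge_adj S) v p) =
   \sum_(ds <- edge_embeddings p)
     #|[set S in spanning_trees G | all (fun d => d.1 \in S) ds]%SET|)%N.
Proof.
under [RHS]eq_bigr do rewrite -sum1_card big_mkcond.
rewrite exchange_big big_mkcond /=; apply: eq_bigr => S _.
case: ifP => SS; last by rewrite big1 // => ds _; rewrite inE SS.
rewrite -sum1_size; move: SS; rewrite inE => /asboolP St.
rewrite -(sum_edge_embeddings p (fun=> 1%N) St) big_mkcond; apply: eq_bigr => ds _.
by rewrite !inE (asboolT St).
Qed.

Context (R : realType) (Gc : connected_graph G).

(* Two adjacent vertices of the tree have different colours, so that all edges
   can be oriented from one colour to the other; this makes them compatible. *)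
Lemma card_spanning_trees_embedding p ds : recursive_tree p ->
  ds \in edge_embeddings p -> exists2 F : 'I_(size p) -> oedge G,
  #|[set S in spanning_trees G | all (fun d => d.1 \in S) ds]%SET|%:R =
    #|spanning_trees G|%:R * \det (\matrix_(i, j) transfer_impedance (F i) (F j)) :> R
  & forall i j, [/\ ~~ self_edge (F i).1, compatibly_oriented (F i) (F j)
      & common_endpoints (F i).1 (F j).1 = #|tree_edge i :&: tree_edge j|].
Proof.
move=> pp dsp; have sz := edge_embedding_size dsp.
have uh : uniq (rev (heads ds)) by rewrite rev_uniq (edge_embedding_uniq dsp).
have sh : size (rev (heads ds)) = (size p).+1 by rewrite size_rev size_rcons size_map sz.
have [col colP] := tree_colouring pp.
(* A tree without edges offers no default edge for [nth]; its determinant is empty. *)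
case: (posnP (size p)) => [p0|pgt0].
  have noI (i : 'I_(size p)) : False by move: (ltn_ord i); rewrite [X in (_ < X)%N]p0.
  exists (fun i => False_rect _ (noI i)) => [|i]; last by case: (noI i).
  have -> : ds = [::] by apply/size0nil; rewrite sz.
  rewrite [X in _ = _ * \det X](_ : _ = 1%:M).
    by rewrite det1 mulr1; congr _%:R; apply: eq_card => S; rewrite inE andbT.
  by apply/matrixP => i; case: (noI i).
have [d0 _] : exists d : oedge G, true by case: ds sz {dsp uh sh} => [|d ds] sz; [rewrite -sz in pgt0 | exists d].
pose x k := nth v (rev (heads ds)) k.
have x_inj k l : (k <= size p)%N -> (l <= size p)%N -> x k = x l -> k = l.
  by move=> kp lp /eqP; rewrite nth_uniq ?sh // => /eqP.
pose d i := nth d0 (rev ds) i.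
have dP i (ip : (i < size p)%N) := edge_embedding_nth d0 pp dsp ip.
have parle (i : 'I_(size p)) : (tree_parent p i <= i)%N by apply: recursive_tree_nth_le.
(* Reversal where the tail has colour [true] gives all tails the colour [false] and all heads the
   colour [true], so a common endpoint plays the same role in both edges. *)
pose F (i : 'I_(size p)) := if col (tree_parent p i) then rev_oedge (d i) else d i.
have F1 i : (F i).1 = (d i).1 by rewrite /F; case: ifP.
have endF i : endpoints (F i).1 = [set x (tree_parent p i); x i.+1]%SET.
  rewrite F1 /x; have [<- <-] := dP i (ltn_ord i); rewrite -/(d i).
  by rewrite /endpoints /otail /ohead; case: (d i).2 => //; rewrite finset.setUC.
have tailF i : exists k, [/\ (k <= size p)%N, otail (F i) = x k & col k = false].
  rewrite /F; have [t h] := dP i (ltn_ord i); case: ifP => c.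
    exists i.+1; rewrite otail_rev h; split => //.
    by rewrite colP // c.
  by exists (tree_parent p i); rewrite t; split => //; rewrite (leq_trans (parle i)) // ltnW.
have headF i : exists k, [/\ (k <= size p)%N, ohead (F i) = x k & col k = true].
  rewrite /F; have [t h] := dP i (ltn_ord i); case: ifP => c.
    by exists (tree_parent p i); rewrite ohead_rev t; split => //; rewrite (leq_trans (parle i)) // ltnW.
  exists i.+1; rewrite h; split => //.
  by rewrite colP // c.
have neF i : otail (F i) != ohead (F i).
  have [k [kp -> ck]] := tailF i; have [l [lp -> cl]] := headF i.
  by apply/eqP => /(x_inj _ _ kp lp) kl; rewrite -kl ck in cl.
have xE (i : 'I_(size p)) : [set x (tree_parent p i); x i.+1]%SET = [set x k | k : 'I_(size p).+1 in tree_edge i]%SET.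
  rewrite /tree_edge imsetU !imset_set1 inordK /=; last by rewrite ltnS (leq_trans (parle i)) // ltnW.
  by rewrite /bump add1n.
have xinj : injective (fun k : 'I_(size p).+1 => x k).
  by move=> k l /x_inj kl; apply/val_inj/kl; rewrite -ltnS.
exists F => [|i j].
  rewrite -(transfer_impedance_theorem R v Gc).
    congr _%:R; apply: eq_card => S; rewrite !inE; congr (_ && _).
    apply/allP/forallP => [dsS i|FS d'].
      by rewrite F1 dsS // -mem_rev mem_nth // size_rev sz.
    rewrite -mem_rev => /(nthP d0)[i]; rewrite size_rev sz => ip <-.
    by have := FS (Ordinal ip); rewrite F1.
  move=> i j /= Fij; have : (x i.+1 \in endpoints (F j).1) by rewrite -Fij endF !inE eqxx orbT.
  have : (x j.+1 \in endpoints (F i).1) by rewrite Fij endF !inE eqxx orbT.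
  rewrite !endF !inE.
  have hi := parle i; have hj := parle j; have := ltn_ord i; have := ltn_ord j.
  move=> jp ip /orP[] /eqP/x_inj h1 /orP[] /eqP/x_inj h2; apply/val_inj => /=; lia.
split.
- rewrite F1; have := neF i; rewrite /F /self_edge.
  by case: ifP => _; case: (d i) => e [] /=; rewrite /otail /ohead /= // eq_sym.
- move=> a; rewrite !endF -!endF => ai aj.
  have mem k : a \in endpoints (F k).1 -> a = otail (F k) \/ a = ohead (F k).
    rewrite /endpoints /otail /ohead; case: (F k).2; rewrite !inE => /orP[] /eqP ->; tauto.
  have [k [kp ti ck]] := tailF i; have [l [lp hi cl]] := headF i.
  have [k' [kp' tj ck']] := tailF j; have [l' [lp' hj cl']] := headF j.
  have no k0 l0 : (k0 <= size p)%N -> (l0 <= size p)%N -> col k0 = false ->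
      col l0 = true -> x k0 <> x l0.
    by move=> k0p l0p c c' /(x_inj _ _ k0p l0p) kl; rewrite -kl c in c'.
  case: (mem i ai) => ai'; case: (mem j aj) => aj'; [by left| | |by right].
    by case: (no k l' kp lp' ck cl'); rewrite -ti -hj -ai' -aj'.
  by case: (no k' l kp' lp ck' cl); rewrite -tj -hi -ai' -aj'.
- by rewrite /common_endpoints !endF !xE -imsetI ?card_imset // => ? ? _ _; apply: xinj.
Qed.

End EdgeEmbeddings.

Section BigContinuous.
Context (R : realType) (T : topologicalType) (I : Type) (r : seq I) (F : I -> T -> R).

Lemma sum_continuous : (forall i, continuous (F i)) ->
  continuous (fun x => \sum_(i <- r) F i x).
Proof.
move=> Fc x; elim: r => [|i s IH].
  by under eq_fun do rewrite big_nil; exact: cvg_cst.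
by rewrite /continuous_at; under eq_fun do rewrite big_cons; rewrite big_cons; apply: cvgD => //; exact: Fc.
Qed.

Lemma prod_continuous : (forall i, continuous (F i)) ->
  continuous (fun x => \prod_(i <- r) F i x).
Proof.
move=> Fc x; elim: r => [|i s IH].
  by under eq_fun do rewrite big_nil; exact: cvg_cst.
by rewrite /continuous_at; under eq_fun do rewrite big_cons; rewrite big_cons; apply: cvgM => //; exact: Fc.
Qed.

Lemma scale_continuous (c : R) (f : T -> R) : continuous f -> continuous (fun x => c * f x).
Proof. by move=> fc x; apply: cvgM; [exact: cvg_cst | exact: fc]. Qed.

End BigContinuous.

Lemma det_close (R : realType) (m : nat) (N : 'M[R]_m) (eta : R) : 0 < eta ->
  exists2 eps : R, 0 < eps & forall A : 'M[R]_m,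
    (forall i j, `|N i j - A i j| < eps) -> `|\det N - \det A| < eta.
Proof.
move=> eta0; have det_cont : continuous (fun A : 'M[R]_m => \det A).
  apply: sum_continuous => s; apply: scale_continuous; apply: prod_continuous => i.
  exact: coord_continuous.
have : nbhs N (fun A => `|\det N - \det A| < eta).
  exact: (@cvgr_dist_lt _ _ _ _ _ _ _ (det_cont N) eta eta0).
case/nbhs_ballP => eps eps0 h; by exists eps => // A NA; apply: h; split => [|i j]; [exact: eps0 | exact: NA].
Qed.

Lemma card_preimage_le (T : finType) (U : eqType) (P : pred T) (f : T -> U) (s : seq U) :
  (#|[pred d | P d && (f d \in s)]| <= \sum_(y <- s) #|[pred d | P d && (f d == y)]|)%N.
Proof.
elim: s => [|y s IH].
  by rewrite big_nil eq_card0 // => d; rewrite !inE andbF.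
rewrite big_cons; apply: leq_trans (leq_add (leqnn _) IH).
rewrite -cardUI; apply: leq_trans (leq_addr _ _).
apply: subset_leq_card; apply/fintype.subsetP => d.
by rewrite !inE => /andP[->].
Qed.

(** * Kirchhoff's law and edge multiplicities *)

Section Degrees.
Context (R : realType) (G : mgraph) (v : vertex G).
Implicit Types (x y : vertex G) (d : oedge G).

Lemma self_edgeE d : self_edge d.1 = (otail d == ohead d).
Proof. by case: d => e []; rewrite /self_edge /otail /ohead //= eq_sym. Qed.

Lemma endpointsE d : endpoints d.1 = [set otail d; ohead d]%SET.
Proof. by case: d => e []; rewrite /endpoints /otail /ohead //= finset.setUC. Qed.

Lemma card_out_edges x :
  #|[pred d : oedge G | (otail d == x) && (ohead d != x)]| = deg_star x.
Proof.
pose A := [set d : oedge G | (otail d == x) && (ohead d != x)]%SET.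
transitivity #|[set d.1 | d in A]%SET|.
  rewrite card_in_imset; first by apply: eq_card => d; rewrite !inE.
  move=> d d'; rewrite !inE => /andP[/eqP dx dx'] /andP[/eqP d'x d'x'].
  by case/oedge_same_edge => // d'E; rewrite d'E otail_rev in d'x; rewrite d'x eqxx in dx'.
apply: eq_card => e; rewrite inE; apply/imsetP/andP => [[d + ->]|[ne]].
  by rewrite inE self_edgeE endpointsE => /andP[/eqP <- dh]; rewrite !inE eqxx eq_sym dh.
rewrite (self_edgeE (e, true)) (endpointsE (e, true)) !inE in ne *.
case/orP => /eqP xe; first by exists (e, true); rewrite // inE xe eqxx eq_sym.
by exists (rev_oedge (e, true)); rewrite // inE otail_rev ohead_rev xe eqxx.
Qed.

Definition multiplicity x y : nat :=
  #|[pred d : oedge G | (otail d == x) && (ohead d == y)]|.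

(* Kirchhoff's law at the tail of [d0] for the unit current from its tail to its
   head. *)
Lemma sum_transfer_impedance (Gc : connected_graph G) d0 :
  otail d0 != ohead d0 ->
  \sum_(d : oedge G | (otail d == otail d0) && (ohead d != otail d0))
    transfer_impedance d0 d = 1 :> R.
Proof.
move=> ne; have := @potentialP R G v Gc (otail d0) (ohead d0) (otail d0).
rewrite eqxx (negbTE ne) mulr1n mulr0n subr0 => kirchhoff; rewrite -[RHS]kirchhoff.
rewrite [RHS](bigID (fun d => ohead d != otail d0)) /= [X in _ = _ + X]big1 ?addr0 //.
by move=> d /andP[/eqP -> /negPn/eqP ->]; rewrite subrr.
Qed.

(* The hypotheses of the theorem at a fixed [k], with [eta] for [o(1)]. *)
Definition nearly_regular (k : nat) (eta : R) : Prop :=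
  (forall x, (1 - eta) * k%:R <= (deg_star x)%:R <= (1 + eta) * k%:R) /\
  forall d d', ~~ self_edge d.1 -> ~~ self_edge d'.1 -> compatibly_oriented d d' ->
    exists2 delta : R, `|delta| < eta
      & transfer_impedance d d' = k%:R^-1 * ((common_endpoints d.1 d'.1)%:R + delta).

(** In Kirchhoff's law an edge at [x] contributes about 1/k, and an edge parallel to [d0] about 2/k
    because it shares both endpoints. The total is 1, and the degree alone accounts for at least
    [(1 - eta) ^ 2] of it, which leaves less than [2 * eta] for the excess. *)
Lemma multiplicity_le (Gc : connected_graph G) (k : nat) (eta : R) x y :
  (0 < k)%N -> 0 < eta <= 1 -> nearly_regular k eta -> x != y ->
  (multiplicity x y)%:R <= 2 * eta * k%:R.
Proof.
move=> k0 /andP[eta0 eta1] [degP MP] xy.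
have k_gt0 : 0 < k%:R :> R by rewrite ltr0n.
case: (pickP [pred d : oedge G | (otail d == x) && (ohead d == y)]) => [d0|no]; last first.
  by rewrite /multiplicity (eq_card0 no) !mulr_ge0 // ltW.
move=> /andP[/eqP d0x /eqP d0y].
have ne : otail d0 != ohead d0 by rewrite d0x d0y.
pose A := [pred d : oedge G | (otail d == x) && (ohead d != x)].
have Mge d : d \in A -> k%:R^-1 * (1 - eta + (ohead d == y)%:R) <= transfer_impedance d0 d.
  rewrite inE => /andP[/eqP dx dx'].
  have common : common_endpoints d0.1 d.1 = (1 + (ohead d == y))%N.
    rewrite /common_endpoints !endpointsE d0x d0y dx finset.setIUl.
    have -> : ([set x] :&: [set x; ohead d] = [set x])%SET.
      by apply/setP => z; rewrite !inE; case: (z == x).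
    rewrite cardsU1 !inE (negbTE xy) /=; congr (_ + _)%N.
    rewrite (_ : (_ :&: _)%SET = if ohead d == y then [set y]%SET else finset.set0).
      by case: ifP => _; rewrite ?cards1 ?cards0.
    case: (eqVneq (ohead d) y) => [->|oy]; apply/setP => z; rewrite !inE;
      case: (eqVneq z y) => [->|zy] //=; first by rewrite orbT.
    by rewrite eq_sym (negbTE xy) eq_sym (negbTE oy).
  have [| | |delta + ->] := MP d0 d.
  - by rewrite self_edgeE.
  - by rewrite self_edgeE dx eq_sym.
  - move=> a; rewrite !endpointsE d0x d0y dx !inE.
    case/orP => /eqP ->; first by left.
    by rewrite eq_sym (negbTE xy) /= => /eqP ->; right.
  rewrite ltr_norml => /andP[dl _]; rewrite ler_pM2l ?invr_gt0 // common natrD.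
  lra.
have : \sum_(d in A) k%:R^-1 * (1 - eta + (ohead d == y)%:R) <= 1 :> R.
  rewrite -[leRHS](sum_transfer_impedance Gc ne) d0x; apply: ler_sum => d dA.
  exact: Mge.
rewrite -big_distrr big_split /= sumr_const card_out_edges.
rewrite -[_ *+ deg_star x]mulr_natl.
have -> : \sum_(d in A) (ohead d == y)%:R = (multiplicity x y)%:R :> R.
  rewrite -natr_sum -big_mkcondr sum1_card; congr _%:R; apply: eq_card => d.
  rewrite unfold_in /A !inE; case: (ohead d =P y) => [->|]; rewrite ?andbF //.
  by rewrite (eq_sym y) xy !andbT.
rewrite ler_pdivrMl // mulr1.
have /andP[dl _] := degP x.
have : (1 - eta) * ((1 - eta) * k%:R) <= (1 - eta) * (deg_star x)%:R.
  by rewrite ler_wpM2l // subr_ge0.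
have : 0 <= eta ^+ 2 * k%:R by rewrite mulr_ge0 ?sqr_ge0 // ltW.
nra.
Qed.

(** At most [2 * eta * k] edges lead from [x] to each other vertex of [hs]; the further 1 in the
    constant is the deviation of the degree from [k]. *)
Lemma card_extension_edges (Gc : connected_graph G) (k : nat) (eta : R)
    (hs : seq (vertex G)) x : (0 < k)%N -> 0 < eta <= 1 -> nearly_regular k eta ->
  x \in hs ->
  `|#|[pred d : oedge G | (otail d == x) && (ohead d \notin hs)]|%:R - k%:R| <=
    (2 * (size hs)%:R + 1) * eta * k%:R.
Proof.
move=> k0 eta01 reg xhs.
have k_gt0 : 0 < k%:R :> R by rewrite ltr0n.
have /andP[eta0 eta1] := eta01.
set c := #|_|.
have up : (c <= deg_star x)%N.
  rewrite -card_out_edges; apply: subset_leq_card; apply/fintype.subsetP => d.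
  by rewrite !inE => /andP[-> dh] /=; apply: contraNneq dh => ->.
pose P d := (otail d == x) && (ohead d != x).
have lo : (deg_star x <= c + \sum_(y <- hs) #|[pred d | P d && (ohead d == y)]|)%N.
  rewrite -card_out_edges -(cardID (fun d : oedge G => ohead d \notin hs)) leq_add //.
    by apply: subset_leq_card; apply/fintype.subsetP => d; rewrite !inE => /andP[/andP[-> _]].
  apply: leq_trans (card_preimage_le P (@ohead G) hs); apply: subset_leq_card.
  by apply/fintype.subsetP => d; rewrite !inE unfold_in negbK andbC.
have sum_le : (\sum_(y <- hs) #|[pred d | P d && (ohead d == y)]|)%:R <=
    (size hs)%:R * (2 * eta * k%:R).
  rewrite natr_sum -sum1_size natr_sum big_distrl /=; apply: ler_sum => y _; rewrite mul1r.
  have [xy|yx] := eqVneq x y.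
    rewrite eq_card0 => [|d]; first by rewrite !mulr_ge0 // ltW.
    by rewrite !inE /P -xy; case: (ohead d == x); rewrite ?andbF.
  apply: le_trans (multiplicity_le Gc k0 eta01 reg yx); rewrite ler_nat.
  apply: subset_leq_card; apply/fintype.subsetP => d.
  by rewrite !inE => /andP[/andP[-> _]].
have [/(_ x)/andP[dlo dup] _] := reg.
move: up lo; rewrite -(ler_nat R) -[in X in _ -> X -> _](ler_nat R) natrD => up lo.
have : 0 <= (size hs)%:R * (2 * eta * k%:R) by rewrite !mulr_ge0 // ltW.
rewrite ler_norml; move: sum_le; set s := _%:R => sum_le s0; apply/andP; split; lra.
Qed.

End Degrees.

Lemma min_deg_star_le (G : mgraph) (v x : vertex G) : (min_deg_star v <= deg_star x)%N.
Proof.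
rewrite /min_deg_star; have : x \in index_enum (vertex G) by rewrite mem_index_enum.
elim: (index_enum _) => // y s IH; rewrite in_cons big_cons => /predU1P[<-|/IH h].
  exact: geq_minl.
exact: leq_trans (geq_minr _ _) h.
Qed.

(** * Asymptotic numbers and probabilities of copies *)

Section Asymptotics.
Context (R : realType) (G : nat -> mgraph) (v : forall k, vertex (G k)).
Hypothesis Gconn : forall k, connected_graph (G k).
Hypothesis Gmax : one_plus_o1_times (fun k => (max_deg_star (G k))%:R : R) (fun k => k%:R).
Hypothesis Gmin : one_plus_o1_times (fun k => (min_deg_star (v k))%:R : R) (fun k => k%:R).
Hypothesis GM : uniform_impedance R G.

Lemma nearly_regular_near (eta : R) : 0 < eta <= 1 ->
  \forall k \near \oo, nearly_regular (G k) k eta.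
Proof.
(* The [1 + o(1)] factors stand in front of the degrees. Half of [eta] suffices, as [1 + eta] times
   [1 - eta / 2] is at least 1 for [eta <= 1], and [1 - eta] times [1 + eta / 2] is at most 1. *)
case/andP => eta0 eta1; have h0 : 0 < eta / 2 by lra.
have [em /cvgr0_norm_lt/(_ _ h0) em0 emE] := Gmax.
have [ei /cvgr0_norm_lt/(_ _ h0) ei0 eiE] := Gmin.
have := GM eta0; apply: filter_app; near=> k; move=> MP; split => // x.
have : (`|em k| < eta / 2) by near: k.
have : (`|ei k| < eta / 2) by near: k.
have : k%:R = (1 + em k) * (max_deg_star (G k))%:R by near: k.
have : k%:R = (1 + ei k) * (min_deg_star (v k))%:R by near: k.
move=> Ei Em; rewrite !ltr_norml => /andP[i1 i2] /andP[m1 m2].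
have : (deg_star x)%:R <= (max_deg_star (G k))%:R :> R.
  by rewrite ler_nat /max_deg_star leq_bigmax.
have : (min_deg_star (v k))%:R <= (deg_star x)%:R :> R.
  by rewrite ler_nat min_deg_star_le.
have mi0 : 0 <= (min_deg_star (v k))%:R :> R by [].
have ma0 : 0 <= (max_deg_star (G k))%:R :> R by [].
move: Ei Em mi0 ma0; set mi := (min_deg_star _)%:R; set ma := (max_deg_star _)%:R.
set dg := (deg_star _)%:R; move=> Ei Em mi0 ma0 lo hi; apply/andP; split.
  apply: le_trans lo; rewrite Ei mulrA ler_piMl //; nra.
apply: le_trans hi _; rewrite Em mulrA ler_peMl //; nra.
Unshelve. all: by end_near.
Qed.

Definition embedding_ratio (p : seq nat) (k : nat) : R :=
  (size (edge_embeddings (v k) p))%:R / k%:R ^+ size p.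

Lemma edge_embeddings_ratio p : recursive_tree p -> embedding_ratio p @ \oo --> (1 : R).
Proof.
elim: p => [|a p IH] /=.
  move=> _; rewrite (_ : embedding_ratio [::] = fun=> 1); first exact: cvg_cst.
  by apply/funext => k; rewrite /embedding_ratio /= divr1.
case/andP => ap pp; have {}IH := IH pp.
apply/cvgrPdist_le => eps eps0.
(* The constant of [card_extension_edges] for an embedding with [(size p).+1] vertices. As
   [C * eta <= eps / 4] and the ratio for [p] is at most 2, the new vertex costs at most
   [eps / 2]. *)
pose C : R := 2 * (size p).+1%:R + 1.
have C0 : 0 < C by rewrite /C; have : 0 <= (size p).+1%:R :> R by []; lra.
pose eta := Num.min 1 (eps / (4 * C)).
have eta0 : 0 < eta by rewrite lt_min ltr01 divr_gt0 // mulr_gt0.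
have eta1 : eta <= 1 by rewrite ge_min lexx.
have etaC : C * eta <= eps / 4.
  have : eta <= eps / (4 * C) by rewrite ge_min lexx orbT.
  rewrite -(ler_pM2l C0) (_ : C * (eps / (4 * C)) = eps / 4) //.
  by field; rewrite gt_eqF.
have e20 : 0 < Num.min (eps / 2) 1 :> R by rewrite lt_min ltr01 divr_gt0.
move/cvgrPdist_le: IH => /(_ _ e20) IH'.
have := nearly_regular_near (introT andP (conj eta0 eta1)).
apply: filter_app; near=> k; move=> reg.
have k0 : (0 < k)%N by near: k; exact: nbhs_infty_gt.
have : `|1 - embedding_ratio p k| <= Num.min (eps / 2) 1 by near: k; exact: IH'.
rewrite le_min => /andP[u1 u2].
have kR : 0 < k%:R :> R by rewrite ltr0n.
have step : `|embedding_ratio (a :: p) k - embedding_ratio p k| <= C * eta * embedding_ratio p k.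
  rewrite /embedding_ratio [size (a :: p)]/= exprS.
  have -> : (size (edge_embeddings (v k) (a :: p)))%:R / (k%:R * k%:R ^+ size p) -
      (size (edge_embeddings (v k) p))%:R / k%:R ^+ size p =
      ((size (edge_embeddings (v k) (a :: p)))%:R - (size (edge_embeddings (v k) p))%:R * k%:R)
      * (k%:R * k%:R ^+ size p)^-1 :> R.
    by field; rewrite expf_neq0 // gt_eqF.
  rewrite normrM (ger0_norm (x := _^-1)); last by rewrite invr_ge0 mulr_ge0 ?exprn_ge0.
  rewrite ler_pdivrMr ?mulr_gt0 ?exprn_gt0 //.
  have -> : C * eta * ((size (edge_embeddings (v k) p))%:R / k%:R ^+ size p) * (k%:R * k%:R ^+ size p)
      = (size (edge_embeddings (v k) p))%:R * (C * eta * k%:R).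
    by field; rewrite expf_neq0 // gt_eqF.
  rewrite -sum1_size (big_edge_embeddings _ _ _ (fun=> 1%N)) -sum1_size !natr_sum.
  rewrite !big_distrl /= -sumrB; apply: le_trans (ler_norm_sum _ _ _) _.
  rewrite big_seq [leRHS]big_seq; apply: ler_sum => ds dsp; rewrite !mul1r sum1_card.
  have sh : size (heads (v k) ds) = (size p).+1.
    by rewrite size_rcons size_map (edge_embedding_size dsp).
  rewrite /C -sh; apply: (card_extension_edges (v k)) => //.
    by rewrite eta0.
  by rewrite -mem_rev mem_nth // size_rev sh.
have u0 : 0 <= embedding_ratio p k by rewrite divr_ge0 ?exprn_ge0.
move: u1 u2 step; rewrite !ler_norml => /andP[a1 a2] /andP[b1 b2] /andP[c1 c2].
have : C * eta * embedding_ratio p k <= eps / 4 * 2.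
  by apply: ler_pM => //; [rewrite mulr_ge0 // ltW | lra].
by move=> h; apply/andP; split; lra.
Unshelve. all: by end_near.
Qed.

Lemma spanning_trees_gt0 k : 0 < #|spanning_trees (G k)|%:R :> R.
Proof.
rewrite ltr0n; have [f gf _] := @connected_grounds _ (v k) _ (@Gconn k).
by apply/card_gt0P; exists (selected_edges f); apply: grounds_spanning gf.
Qed.

Lemma mean_tree_embeddings p : recursive_tree p ->
  (fun k => (\sum_(S in spanning_trees (G k))
      (size (tree_embeddings (edge_adj S) (v k) p))%:R) / #|spanning_trees (G k)|%:R)
    @ \oo --> ((size p).+1%:R : R).
Proof.
move=> pp; apply/cvgrPdist_le => eps eps0.
(* The determinants may deviate by [eps / 4] because the ratio of copies is at most 2; the other
   half of [eps] is spent on the number of copies. *)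
have e40 : 0 < eps / 4 by lra.
have [del del0 delP] := @det_close R _ (\matrix_(i, j) #|tree_edge i :&: tree_edge (p := p) j|%:R) _ e40.
rewrite det_tree_gram // in delP.
have M0 : 0 < (size p).+1%:R :> R by [].
pose eta := Num.min 1 del.
have eta0 : 0 < eta by rewrite lt_min ltr01.
have eta1 : eta <= 1 by rewrite ge_min lexx.
have e20 : 0 < Num.min (eps / (2 * (size p).+1%:R)) 1 :> R by rewrite lt_min ltr01 divr_gt0 ?mulr_gt0.
have /cvgrPdist_le/(_ _ e20) ratio := edge_embeddings_ratio pp.
have := nearly_regular_near (introT andP (conj eta0 eta1)).
apply: filter_app; near=> k; move=> [_ MP].
have k0 : (0 < k)%N by near: k; exact: nbhs_infty_gt.
have : `|1 - embedding_ratio p k| <= Num.min (eps / (2 * (size p).+1%:R)) 1 by near: k; exact: ratio.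
rewrite le_min => /andP[u1 u2].
have kR : 0 < k%:R :> R by rewrite ltr0n.
have st0 := spanning_trees_gt0 k.
rewrite -natr_sum sum_card_tree_embeddings natr_sum.
have term ds : ds \in edge_embeddings (v k) p ->
  `|(size p).+1%:R / k%:R ^+ size p -
    #|[set S in spanning_trees (G k) | all (fun d => d.1 \in S) ds]%SET|%:R
      / #|spanning_trees (G k)|%:R| <= eps / 4 / k%:R ^+ size p :> R.
  move=> dsp; have [F -> FP] := card_spanning_trees_embedding R (@Gconn k) pp dsp.
  rewrite mulrAC divff ?gt_eqF // mul1r.
  pose A : 'M[R]_(size p) := \matrix_(i, j) (k%:R * transfer_impedance (F i) (F j)).
  have -> : \matrix_(i, j) transfer_impedance (F i) (F j) = k%:R^-1 *: A.
    by apply/matrixP => i j; rewrite !mxE mulKf // gt_eqF.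
  rewrite detZ exprVn mulrC -mulrBr normrM ger0_norm ?invr_ge0 ?exprn_ge0 // mulrC.
  rewrite ler_wpM2r ?invr_ge0 ?exprn_ge0 //; apply/ltW/delP => i j; rewrite !mxE.
  have [ni cij comm] := FP i j; have [nj _ _] := FP j i.
  have [delta dlt ->] := MP _ _ ni nj cij.
  rewrite mulVKf ?gt_eqF // comm opprD addrA subrr add0r normrN.
  by apply: lt_le_trans dlt _; rewrite ge_min lexx orbT.
have main : `|(size p).+1%:R * embedding_ratio p k -
    (\sum_(ds <- edge_embeddings (v k) p)
      #|[set S in spanning_trees (G k) | all (fun d => d.1 \in S) ds]%SET|%:R)
      / #|spanning_trees (G k)|%:R| <= eps / 4 * embedding_ratio p k.
  rewrite /embedding_ratio -(sum1_size (edge_embeddings (v k) p)) natr_sum.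
  rewrite !big_distrl !big_distrr /= -sumrB.
  apply: le_trans (ler_norm_sum _ _ _) _.
  rewrite big_seq [leRHS]big_seq; apply: ler_sum => ds dsp.
  by rewrite mul1r; apply: term.
have : (size p).+1%:R * `|1 - embedding_ratio p k| <= eps / 2.
  rewrite -(ler_pM2l M0) in u1; apply: le_trans u1 _.
  rewrite (_ : _ * (eps / _) = eps / 2) //.
  by field; rewrite gt_eqF.
rewrite -{1}(ger0_norm (ltW M0)) -normrM.
move: u2 main; rewrite !ler_norml => /andP[b1 b2] /andP[c1 c2] /andP[d1 d2].
have : eps / 4 * embedding_ratio p k <= eps / 4 * 2 by rewrite ler_pM2l //; lra.
by move=> h; apply/andP; split; lra.
Unshelve. all: by end_near.
Qed.

End Asymptotics.

(** * Factorial moments and the limit of the truncations *)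

Lemma alternating_bin_sum (R : pzRingType) (N J : nat) :
  \sum_(0 <= j < J.+1) (-1) ^+ j * 'C(N.+1, j)%:R = (-1) ^+ J * 'C(N, J)%:R :> R.
Proof.
elim: J => [|J IH]; first by rewrite big_nat1 !bin0 expr0 mul1r.
by rewrite big_nat_recr //= IH binS natrD mulrDr addrCA exprS mulN1r !mulNr subrr addr0.
Qed.

(** For a positive number [N.+1] the alternating sum is, up to sign, ['C(N, J)], one of the two
    summands of the bound in Pascal's rule. *)
Lemma Bonferroni (R : numDomainType) (N J : nat) :
  `|(N == 0%N)%:R - \sum_(0 <= j < J.+1) (-1) ^+ j * 'C(N, j)%:R| <= 'C(N, J.+1)%:R :> R.
Proof.
case: N => [|N].
  rewrite big_nat_recl //= bin0 expr0 mulr1 big1 => [|j _]; last by rewrite bin0n mulr0.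
  by rewrite addr0 subrr normr0.
rewrite alternating_bin_sum sub0r normrN normrM normrX normrN1 expr1n mul1r.
by rewrite normr_nat ler_nat binS leq_addl.
Qed.

Section LimitSeries.
Context (R : realType) (a n : nat).

(** The limiting mean of ['C(N, j)], summed over embeddings, with [N] the number of outer
    neighbours: [j] ordered leaves can be attached in [a ^ j] ways, and each resulting tree has
    [n + j] vertices. *)
Definition limit_term (j : nat) : R := a%:R ^+ j * (n + j)%:R / j`!%:R.

(** In the part of [n + j] with [j], this factor cancels against the factorial, which leaves [- a]
    times the exponential series one step behind. *)
Lemma limit_term_partial_sum J :
  \sum_(0 <= j < J.+1) (-1) ^+ j * limit_term j =
  n%:R * series (exp_coeff (- a%:R)) J.+1 - a%:R * series (exp_coeff (- a%:R)) J :> R.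
Proof.
have e j : exp_coeff (- a%:R) j = (-1) ^+ j * a%:R ^+ j / j`!%:R :> R.
  by rewrite /exp_coeff /= -mulN1r exprMn.
elim: J => [|J IH].
  rewrite /series /= !big_nat1 big_geq // e mulr0 subr0 /limit_term addn0 !expr0 fact0.
  by rewrite !mul1r !divr1 ?mulr1.
rewrite big_nat_recr //= IH /series /= [in RHS]big_nat_recr //= [X in _ = _ - _ * X]big_nat_recr //=.
rewrite !e /limit_term !factS !natrM natrD exprS.
have f0 : J`!%:R != 0 :> R by rewrite pnatr_eq0 -lt0n fact_gt0.
have J0 : J.+1%:R != 0 :> R by rewrite pnatr_eq0.
rewrite [a%:R ^+ J.+1]exprS.
by field; rewrite f0 nat1r J0.
Qed.

Lemma limit_series_cvg :
  (fun J => \sum_(0 <= j < J.+1) (-1) ^+ j * limit_term j) @ \oo -->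
  ((n%:R - a%:R) * expR (- a%:R) : R).
Proof.
rewrite (_ : (fun J => _) = (fun J => n%:R * series (exp_coeff (- a%:R)) J.+1 -
    a%:R * series (exp_coeff (- a%:R)) J)); last first.
  by apply/funext => J; rewrite limit_term_partial_sum.
have s : series (exp_coeff (- a%:R)) @ \oo --> expR (- a%:R : R).
  exact: is_cvg_series_exp_coeff.
rewrite mulrBl; apply: cvgB; last by apply: cvgMr.
by apply: cvgMr; rewrite (cvg_shiftS (series (exp_coeff (- a%:R)))).
Qed.

Lemma limit_term_cvg0 : limit_term J.+1 @[J --> \oo] --> (0 : R).
Proof.
have e : exp_coeff (a%:R : R) j @[j --> \oo] --> (0 : R).
  by apply: cvg_series_cvg_0; apply: is_cvg_series_exp_coeff.
rewrite (_ : (fun J => _) = (fun J => n%:R * exp_coeff (a%:R : R) J.+1 + a%:R * exp_coeff a%:R J)); last first.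
  apply/funext => J; rewrite /limit_term /exp_coeff /= factS !natrM natrD exprS.
  have f0 : J`!%:R != 0 :> R by rewrite pnatr_eq0 -lt0n fact_gt0.
  have J0 : J.+1%:R != 0 :> R by rewrite pnatr_eq0.
  by field; rewrite f0 nat1r J0.
rewrite (_ : (0 : R) = n%:R * 0 + a%:R * 0); last by rewrite !mulr0 addr0.
apply: cvgD; apply: cvgMr => //.
by rewrite (cvg_shiftS (exp_coeff (a%:R : R))); exact: e.
Qed.

(* For random counts [N k], [E j k] is the mean of ['C(N k, j)] and [q k] the
   probability that [N k] vanishes, both possibly summed over several counts. *)
Lemma Bonferroni_cvg (q : nat -> R) (E : nat -> nat -> R) :
  (forall j, E j @ \oo --> limit_term j) ->
  (forall J k, `|q k - \sum_(0 <= j < J.+1) (-1) ^+ j * E j k| <= E J.+1 k) ->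
  q @ \oo --> (n%:R - a%:R) * expR (- a%:R).
Proof.
move=> Ecvg bonf; apply/cvgrPdist_le => eps eps0.
(* One quarter each for the tail of the limit series, the convergence of its partial sum, the limit
   of the Bonferroni bound and the convergence to that limit. *)
have e4 : 0 < eps / 4 by lra.
have [J [J1 J2]] : exists J, `|(n%:R - a%:R) * expR (- a%:R) -
    \sum_(0 <= j < J.+1) (-1) ^+ j * limit_term j| <= eps / 4 /\ `|limit_term J.+1| <= eps / 4.
  have /cvgrPdist_le/(_ _ e4) h1 := limit_series_cvg.
  have /cvgr0_norm_le/(_ _ e4) h2 := limit_term_cvg0.
  near \oo => J; exists J; split; near: J; [exact: h1 | exact: h2].
have S : (fun k => \sum_(0 <= j < J.+1) (-1) ^+ j * E j k) @ \oo -->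
    \sum_(0 <= j < J.+1) (-1) ^+ j * limit_term j.
  elim: (index_iota 0 J.+1) => [|j s IH].
    by under eq_fun do rewrite big_nil; rewrite big_nil; exact: cvg_cst.
  under eq_fun do rewrite big_cons; rewrite big_cons; apply: cvgD => //.
  by apply: cvgMr; exact: Ecvg.
move/cvgrPdist_le : S => /(_ _ e4) S.
have /cvgrPdist_le/(_ _ e4) EJ := Ecvg J.+1.
near=> k.
have : `|\sum_(0 <= j < J.+1) (-1) ^+ j * limit_term j -
         \sum_(0 <= j < J.+1) (-1) ^+ j * E j k| <= eps / 4 by near: k.
have : `|limit_term J.+1 - E J.+1 k| <= eps / 4 by near: k.
move: J1 J2 (bonf J k); rewrite !ler_norml.
move=> /andP[a1 a2] /andP[b1 b2] /andP[c1 c2] /andP[d1 d2] /andP[e1 e2].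
by apply/andP; split; lra.
Unshelve. all: by end_near.
Qed.

End LimitSeries.

Lemma size_lists_of A j : size (lists_of A j) = (size A ^ j)%N.
Proof. by elim: j => //= j IH; rewrite size_allpairs IH expnSr. Qed.

Lemma lists_of_recursive_tree A j g p : recursive_tree p ->
  all (fun a => (a <= size p)%N) A -> g \in lists_of A j ->
  recursive_tree (g ++ p) /\ size g = j.
Proof.
move=> pp /allP Ap; elim: j g => [|j IH] g; first by rewrite inE => /eqP ->.
case/allpairsPdep => g' [b [/IH[gp sg] /Ap bp ->]] /=; rewrite sg gp andbT; split => //.
by rewrite size_cat; lia.
Qed.

Section TruncationLimit.
Context (R : realType) (G : nat -> mgraph) (v : forall k, vertex (G k)).
Hypothesis Gconn : forall k, connected_graph (G k).
Hypothesis Gmax : one_plus_o1_times (fun k => (max_deg_star (G k))%:R : R) (fun k => k%:R).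
Hypothesis Gmin : one_plus_o1_times (fun k => (min_deg_star (v k))%:R : R) (fun k => k%:R).
Hypothesis GM : uniform_impedance R G.
Context (V : finType) (e : rel V) (o : V) (r : nat).
Context (levt : V -> nat) (part : V -> option V).
Hypothesis t_order : @tree_order (finite_rgraph e o) levt part.
Hypothesis t_height : height_le (finite_rgraph e o) r.

Lemma ust_trunc_cvg :
  (fun k => ust_law R (v k) (fun T => riso (trunc T r) (finite_rgraph e o))) @ \oo -->
  (#|[pred x | levt x == r]|%:R * expR (- #|[pred x | (levt x < r)%N]|%:R)
    / #|automorphisms e o|%:R : R).
Proof.
have [p [L [pp Lp Lall]]] := ex_tree_enumeration t_order.
have sL := tree_embedding_size Lp.
pose A := inner_indices o r levt L.
have uA : uniq A by rewrite filter_uniq // iota_uniq.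
have Ap : all (fun a => (a <= size p)%N) A := inner_indices_le r levt Lp.
have sA := size_inner_indices r levt Lp Lall; rewrite -/A in sA.
pose N k (S : {set edge (G k)}) hs := #|outer_neighbours (edge_adj S) (v k) A hs|.
pose emb k (S : {set edge (G k)}) := tree_embeddings (edge_adj S) (v k) p.
(* [E] averages the binomial coefficients of the number of outer neighbours over all embeddings; [q]
   keeps the embeddings that fill the ball, that is, the isomorphisms. *)
pose E j k : R := (\sum_(S in spanning_trees (G k)) \sum_(hs <- emb k S) 'C(N k S hs, j)%:R)
  / #|spanning_trees (G k)|%:R.
pose q k : R := (\sum_(S in spanning_trees (G k)) \sum_(hs <- emb k S) (N k S hs == 0%N)%:R)
  / #|spanning_trees (G k)|%:R.
have Ecvg j : E j @ \oo --> limit_term R (size A) (size p).+1 j.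
  have EE k : E j k = j`!%:R^-1 * \sum_(g <- lists_of A j)
      ((\sum_(S in spanning_trees (G k)) (size (tree_embeddings (edge_adj S) (v k) (g ++ p)))%:R)
        / #|spanning_trees (G k)|%:R).
    rewrite -big_distrl /= exchange_big /= mulrA; congr (_ / _).
    rewrite big_distrr /=; apply: eq_bigr => S; rewrite inE => /asboolP St.
    have [lev [par order]] := spanning_tree_order St (v k).
    have := sum_extensions order j (fun=> 1%N) pp uA Ap.
    under eq_bigr do rewrite sum1_size.
    move=> /(congr1 (fun n : nat => n%:R : R)); rewrite !natr_sum => ->.
    rewrite big_distrr /=; apply: eq_bigr => hs _; rewrite mul1n -bin_ffact natrM.
    by rewrite mulrC mulfK // pnatr_eq0 -lt0n fact_gt0.
  rewrite (funext EE).
  rewrite /limit_term mulrC; apply: cvgMr.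
  have -> : (size A)%:R ^+ j * ((size p).+1 + j)%:R =
      \sum_(g <- lists_of A j) (size (g ++ p)).+1%:R :> R.
    rewrite big_seq (eq_bigr (fun=> ((size p).+1 + j)%:R)) => [|g gA].
      by rewrite -big_seq big_const_seq count_predT iter_addr_0 size_lists_of -natrX mulr_natl.
    have [_ <-] := lists_of_recursive_tree pp Ap gA.
    by rewrite size_cat addnC addSn.
  have : {subset lists_of A j <= lists_of A j} by [].
  elim: {1 3 4}(lists_of A j) => [|g s IH] sub.
    by under eq_fun do rewrite big_nil; rewrite big_nil; exact: cvg_cst.
  under eq_fun do rewrite big_cons; rewrite big_cons; apply: cvgD; last first.
    by apply: IH => x xs; apply: sub; rewrite in_cons xs orbT.
  have [gp _] := lists_of_recursive_tree pp Ap (sub g (mem_head _ _)).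
  exact: (mean_tree_embeddings Gconn Gmax Gmin GM gp).
have bonf J k : `|q k - \sum_(0 <= j < J.+1) (-1) ^+ j * E j k| <= E J.+1 k.
  have st0 := @spanning_trees_gt0 R G v Gconn k.
  under [X in _ - X]eq_bigr do rewrite mulrA.
  rewrite -big_distrl -mulrBl normrM (ger0_norm (x := _^-1)) ?invr_ge0 ?(ltW st0) //.
  rewrite ler_wpM2r ?invr_ge0 ?(ltW st0) //=.
  under [X in _ - X]eq_bigr do rewrite big_distrr /=.
  rewrite [X in _ - X]exchange_big -sumrB; apply: (le_trans (ler_norm_sum _ _ _)); apply: ler_sum => S _ /=.
  under [X in _ - X]eq_bigr do rewrite big_distrr /=.
  rewrite [X in _ - X]exchange_big -sumrB; apply: (le_trans (ler_norm_sum _ _ _)); apply: ler_sum => hs _.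
  exact: Bonferroni.
have Aut0 : #|automorphisms e o|%:R != 0 :> R by rewrite pnatr_eq0 -lt0n automorphisms_gt0.
have qE k : ust_law R (v k) (fun T => riso (trunc T r) (finite_rgraph e o)) =
    #|automorphisms e o|%:R^-1 * q k.
  rewrite /ust_law /q mulrA; congr (_ / _); apply: (mulfI Aut0); rewrite mulVKf //.
  set B := [set S in spanning_trees (G k) | _]%SET.
  rewrite -[#|B|]sum1_card natr_sum big_mkcond big_distrr [RHS]big_mkcond /=.
  apply: eq_bigr => S _; rewrite /B inE; case SS: (S \in spanning_trees _) => /=; last by rewrite mulr0.
  have St : spanning_tree S by move: SS; rewrite inE => /asboolP.
  have [lev [par order]] := spanning_tree_order St (v k).
  have := card_embedding_isos t_order t_height pp Lp Lall order.
  rewrite -sum1_count => /(congr1 (fun n : nat => n%:R : R)).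
  rewrite natr_sum natrM big_mkcond /= => E1.
  rewrite -[LHS]/(_ * (if _ then 1 else 0)) (_ : (if _ then 1 else 0) =
    (`[< riso (trunc (finite_rgraph (edge_adj S) (v k)) r) (finite_rgraph e o) >])%:R); last by case: ifP.
  rewrite -E1; apply: eq_bigr => hs _; by case: ifP.
rewrite (funext qE).
rewrite mulrC; apply: cvgMr.
have -> : #|[pred x | levt x == r]|%:R = (size p).+1%:R - (size A)%:R :> R.
  rewrite -sL -(card_uniqP (tree_embedding_uniq Lp)) sA.
  have -> : #|L| = #|V| by apply: eq_card => x; rewrite inE Lall.
  rewrite -(cardC [pred x | (levt x < r)%N]) natrD addrC addKr; congr _%:R.
  apply: eq_card => x; rewrite !inE -leqNgt eqn_leq.
  by rewrite (tree_order_height t_order t_height).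
rewrite -sA; exact: Bonferroni_cvg Ecvg bonf.
Qed.

End TruncationLimit.

(** * The limit tree *)

Lemma family_vert_rcons n u c :
  family_vert n (rcons u c) = family_vert n u && (c < n u)%N.
Proof.
rewrite /family_vert size_rcons -addn1 iotaD add0n all_cat /= andbT; congr (_ && _).
  apply: eq_in_all => l; rewrite mem_iota add0n => /andP[_ lu].
  by rewrite nth_rcons lu -cats1 take_cat lu.
by rewrite nth_rcons ltnn eqxx -cats1 take_size_cat.
Qed.

(** Defined on all potential individuals: offspring numbers decide only which vertices exist, so
    parents and levels are the same for all outcomes. *)
Definition path_parent (x : nat * seq nat) : option (nat * seq nat) :=
  if x.2 is c :: u then Some (x.1, belast c u)
  else if x.1 is i.+1 then Some (i, [::]) else None.

Definition path_level (x : nat * seq nat) : nat := (x.1 + size x.2)%N.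

Lemma path_parent_rcons i u c : path_parent (i, rcons u c) = Some (i, u).
Proof. by case: u => //= b u; rewrite /path_parent /= belast_rcons. Qed.

Lemma path_parentP x y : path_parent x = Some y <->
  (exists c, x = (y.1, rcons y.2 c)) \/ [/\ x.2 = [::], y.2 = [::] & x.1 = y.1.+1].
Proof.
split=> [|[[c ->]|]].
- case: x => i u; case/lastP: u => [|u c]; last first.
    by rewrite path_parent_rcons => -[<-]; left; exists c.
  by case: i => // i [<-]; right.
- by rewrite path_parent_rcons -surjective_pairing.
- by case: x y => i u [j w] /= [-> -> ->].
Qed.

Lemma path_tree_order n :
  @tree_order (path_with_family_trees n) path_level path_parent.
Proof.
split=> //=.
- move=> [i u] _; split=> [|-> //].
  by case/lastP: u => [|u c]; [case: i | rewrite path_parent_rcons].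
- move=> x y vx /path_parentP[[c xE]|[x2 y2 x1]].
    move: vx; rewrite xE family_vert_rcons /path_level /= size_rcons addnS.
    by case/andP.
  by rewrite y2 /path_level x1 x2 y2 /= !addn0.
- have childP u w : is_child u w <-> exists c, w = rcons u c.
    rewrite /is_child; split=> [/andP[_ /eqP E]|[c ->]]; first by exists (last 0%N w).
    by rewrite last_rcons eqxx andbT -size_eq0 size_rcons.
  move=> x y _ _; rewrite !path_parentP; split.
    case/orP => [/andP[/eqP xy /orP[] /childP[c E]]|/and3P[/eqP x2 /eqP y2 /orP[] /eqP E]].
    + by right; left; exists c; rewrite xy -E -surjective_pairing.
    + by left; left; exists c; rewrite -xy -E -surjective_pairing.
    + by left; right.
    + by right; right.
  case=> [[[c ->]|[x2 y2 E]]|[[c ->]|[y2 x2 E]]] /=.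
  + by rewrite eqxx /family_adj; have /childP -> : exists c0, rcons y.2 c = rcons y.2 c0; [exists c | rewrite orbT].
  + by rewrite x2 y2 E !eqxx /= orbT.
  + by rewrite eqxx /family_adj; have /childP -> : exists c0, rcons x.2 c = rcons x.2 c0; [exists c | ].
  + by rewrite x2 y2 E !eqxx /= !orbT.
Qed.

(** * Isomorphisms onto balls of the limit tree *)

Section OrderedEmbeddings.
Context (V : finType) (e : rel V) (o : V) (r : nat).
Context (levt : V -> nat) (part : V -> option V).
Hypothesis t_order : @tree_order (finite_rgraph e o) levt part.
Hypothesis t_height : height_le (finite_rgraph e o) r.

Let part_lev x w : part x = Some w -> levt x = (levt w).+1.
Proof. by case: t_order => _ _ _ pS _ /(pS x w isT)[]. Qed.

Let partN x : part x = None <-> x = o.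
Proof. by case: t_order => _ _ pN _ _; apply: pN. Qed.

Let levt_o : levt o = 0%N. Proof. by case: t_order. Qed.

Let levt_le x : (levt x <= r)%N := tree_order_height t_order t_height x.

(** For [s] of level [r] and [j <= r], the ancestor of [s] at level [j]; the path vertex [x_j] will
    be its image. *)
Definition spine (s : V) (j : nat) : V := iter (r - j) (fun x => odflt o (part x)) s.

Definition on_spine (s x : V) : bool := x == spine s (levt x).

(** The child on the spine is reached along the infinite path and not by a birth in a family
    tree. *)
Definition side_children (s w : V) : {set V} :=
  [set x | (part x == Some w) && ~~ on_spine s x]%SET.

(* An embedding of the finite tree in [path_with_family_trees n] is determined
   by the vertex [s] sent to [x_r] and by the order in which the remaining
   children of each vertex are born. *)
Definition birth_orders : {set V * {ffun V -> {perm V}}} :=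
  [set i | (levt i.1 == r) && (i.2 \in family (fun w => perm_on (side_children i.1 w)))]%SET.

(** The fuel [n] is one unit per level. If [i.1] has level [r] and [n] is [levt x], the recursion
    stops on the spine and never at the default pairs. *)
Fixpoint ordered_embedding_rec (i : V * {ffun V -> {perm V}}) (n : nat) (x : V) : nat * seq nat :=
  if on_spine i.1 x then (levt x, [::])
  else if n is n'.+1 then
    if part x is Some w then
      let y := ordered_embedding_rec i n' w in
      (y.1, rcons y.2 (index (i.2 w x) (enum (side_children i.1 w))))
    else (0%N, [::])
  else (0%N, [::]).

Definition ordered_embedding i x := ordered_embedding_rec i (levt x) x.

Definition offspring_match i (n : nat -> seq nat -> nat) : bool :=
  [forall w, (levt w < r)%N ==>
     (n (ordered_embedding i w).1 (ordered_embedding i w).2 == #|side_children i.1 w|)].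

Lemma spine_lev s j : levt s = r -> (j <= r)%N -> levt (spine s j) = j.
Proof.
move=> sr; rewrite /spine => jr; rewrite -{2}(subKn jr).
move: (r - j)%N (leq_subr j r) => k; elim: k => [|k IH] kr; first by rewrite subn0.
rewrite iterS; have := IH (ltnW kr); case px: (part _) => [w|] /=.
  by rewrite (part_lev px); lia.
by rewrite ((partN _).1 px) levt_o; lia.
Qed.

Lemma spine_part s j : levt s = r -> (j < r)%N -> part (spine s j.+1) = Some (spine s j).
Proof.
move=> sr jr.
have -> : spine s j = odflt o (part (spine s j.+1)) by rewrite /spine -(subnSK jr) iterS.
case px: (part _) => [w|] //=.
by have := spine_lev sr jr; rewrite ((partN _).1 px) levt_o.
Qed.

Lemma on_spine_spine s j : levt s = r -> (j <= r)%N -> on_spine s (spine s j).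
Proof. by move=> sr jr; rewrite /on_spine spine_lev. Qed.

Lemma on_spine_root s : levt s = r -> on_spine s o.
Proof.
move=> sr; rewrite /on_spine levt_o; apply/eqP; symmetry; apply/partN.
case px: (part _) => [w|//]; have := part_lev px.
by rewrite (spine_lev sr (leq0n r)).
Qed.

Lemma on_spine_part s x w : levt s = r -> on_spine s x -> part x = Some w -> on_spine s w.
Proof.
move=> sr /eqP xs pw; have lx := part_lev pw.
have wr : (levt w < r)%N by rewrite -lx.
by move: pw; rewrite xs lx spine_part // => -[<-]; rewrite on_spine_spine // ltnW.
Qed.

Lemma ordered_embeddingE i x : levt i.1 = r ->
  ordered_embedding i x =
  if on_spine i.1 x then (levt x, [::])
  else if part x is Some w then
    ((ordered_embedding i w).1,
     rcons (ordered_embedding i w).2 (index (i.2 w x) (enum (side_children i.1 w))))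
  else (0%N, [::]).
Proof.
move=> sr; rewrite {1}/ordered_embedding; case px: (part x) => [w|].
  by rewrite (part_lev px) /= px -(part_lev px).
by rewrite ((partN x).1 px) levt_o /= levt_o; case: ifP.
Qed.

Section FixedOrder.
Context (i : V * {ffun V -> {perm V}}).
Hypothesis iO : i \in birth_orders.
Local Notation phi := (ordered_embedding i).

Let sr : levt i.1 = r. Proof. by move: iO; rewrite inE => /andP[/eqP]. Qed.

Let ord_on w : perm_on (side_children i.1 w) (i.2 w).
Proof. by move: iO; rewrite inE => /andP[_ /familyP]; apply. Qed.

Lemma ordered_embedding_side x w : part x = Some w -> ~~ on_spine i.1 x ->
  phi x = ((phi w).1, rcons (phi w).2 (index (i.2 w x) (enum (side_children i.1 w))))
  /\ (index (i.2 w x) (enum (side_children i.1 w)) < #|side_children i.1 w|)%N.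
Proof.
move=> px xs; rewrite ordered_embeddingE // (negbTE xs) px; split => //.
rewrite cardE index_mem mem_enum (perm_closed _ (ord_on w)).
by rewrite inE px eqxx.
Qed.

Lemma ordered_embedding_spine x : on_spine i.1 x -> phi x = (levt x, [::]).
Proof. by move=> xs; rewrite ordered_embeddingE // xs. Qed.

Lemma ordered_embedding_nil x : (phi x).2 = [::] -> on_spine i.1 x.
Proof.
rewrite ordered_embeddingE //; case: ifP => // xs; case px: (part x) => [w|] /=.
  by move/(congr1 size); rewrite size_rcons.
by move: xs; rewrite ((partN x).1 px) on_spine_root.
Qed.

Lemma ordered_embedding_parent x : path_parent (phi x) = omap phi (part x).
Proof.
have [xs|xs] := boolP (on_spine i.1 x); last first.
  case px: (part x) => [w|]; last by rewrite ((partN x).1 px) on_spine_root in xs.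
  by have [-> _] := ordered_embedding_side px xs; rewrite path_parent_rcons -surjective_pairing.
rewrite ordered_embedding_spine //; case px: (part x) => [w|] /=.
  by rewrite (part_lev px) ordered_embedding_spine ?(on_spine_part sr xs px).
by rewrite ((partN x).1 px) levt_o.
Qed.

Lemma ordered_embedding_level x : path_level (phi x) = levt x.
Proof.
move: {2}(levt x) (erefl (levt x)) => n; elim: n x => [|n IH] x lx.
  by case px: (part x) => [w|]; [rewrite (part_lev px) in lx |
    rewrite ((partN x).1 px) ordered_embedding_spine ?on_spine_root // levt_o].
have [xs|xs] := boolP (on_spine i.1 x).
  by rewrite ordered_embedding_spine // /path_level addn0.
case px: (part x) => [w|]; last by rewrite ((partN x).1 px) on_spine_root in xs.
have [-> _] := ordered_embedding_side px xs; have lw := part_lev px.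
by rewrite lw -IH /path_level ?size_rcons ?addnS //; lia.
Qed.

Lemma ordered_embedding_inj : injective phi.
Proof.
move=> x y; move: {2}(levt x) (erefl (levt x)) => n; elim: n x y => [|n IH] x y lx E.
  have ly : levt y = 0%N by rewrite -ordered_embedding_level -E ordered_embedding_level.
  have root z : levt z = 0%N -> z = o.
    by move=> lz; apply/partN; case pz: (part z) => [w|//]; rewrite (part_lev pz) in lz.
  by rewrite (root x lx) (root y ly).
have ly : levt y = n.+1 by rewrite -ordered_embedding_level -E ordered_embedding_level.
case px: (part x) => [w|]; last by rewrite ((partN x).1 px) levt_o in lx.
case py: (part y) => [w'|]; last by rewrite ((partN y).1 py) levt_o in ly.
have ww' : w = w'.
  have := congr1 path_parent E; rewrite !ordered_embedding_parent px py => -[].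
  by apply: IH; have := part_lev px; lia.
have [xs|xs] := boolP (on_spine i.1 x).
  have ys : on_spine i.1 y by apply: ordered_embedding_nil; rewrite -E ordered_embedding_spine.
  by rewrite (eqP xs) (eqP ys) lx ly.
have ys : ~~ on_spine i.1 y.
  by apply: contra xs => ys; apply: ordered_embedding_nil; rewrite E ordered_embedding_spine.
have [Ex ix] := ordered_embedding_side px xs; have [Ey _] := ordered_embedding_side py ys.
have mem z : part z = Some w -> ~~ on_spine i.1 z -> i.2 w z \in enum (side_children i.1 w).
  by move=> pz zs; rewrite mem_enum (perm_closed _ (ord_on w)) inE pz eqxx.
move: E; rewrite Ex Ey -ww' => -[E]; have ij := rcons_injr _ E.
rewrite -ww' in py.
exact: (perm_inj (index_inj o (mem x px xs) (mem y py ys) ij)).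
Qed.

Lemma ordered_embedding_local_iso n : offspring_match i n ->
  @local_iso V r levt part (path_with_family_trees n) path_parent phi.
Proof.
move=> /forallP im.
have nE w : (levt w < r)%N -> n (phi w).1 (phi w).2 = #|side_children i.1 w|.
  by move=> wr; apply/eqP; apply: (implyP (im w)).
split.
- exact: ordered_embedding_inj.
- move=> x; move: {2}(levt x) (erefl (levt x)) => l; elim: l x => [|l IH] x lx.
    have -> : x = o by apply/partN; case px: (part x) => [w|//]; rewrite (part_lev px) in lx.
    by rewrite ordered_embedding_spine ?on_spine_root.
  have [xs|xs] := boolP (on_spine i.1 x); first by rewrite ordered_embedding_spine.
  case px: (part x) => [w|]; last by rewrite ((partN x).1 px) on_spine_root in xs.
  have [-> cx] := ordered_embedding_side px xs; have lw := part_lev px.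
  rewrite /= family_vert_rcons nE -?lw ?levt_le // cx andbT.
  by apply: (IH w); lia.
- exact: ordered_embedding_parent.
- move=> x y xr vy /path_parentP[[c yE]|[y2 x2 y1]].
    move: vy; rewrite yE /= family_vert_rcons nE // => /andP[_ cx].
    pose z := nth o (enum (side_children i.1 x)) c.
    have zK : z \in side_children i.1 x by rewrite -mem_enum mem_nth // -cardE.
    exists ((i.2 x)^-1 z)%g.
    have : ((i.2 x)^-1 z)%g \in side_children i.1 x.
      by rewrite -(perm_closed _ (ord_on x)) permKV.
    rewrite inE => /andP[/eqP px' xs'].
    have [-> _] := ordered_embedding_side px' xs'.
    by rewrite permKV index_uniq ?enum_uniq // -cardE.
  have xs := ordered_embedding_nil x2.
  exists (spine i.1 (levt x).+1).
  rewrite ordered_embedding_spine ?on_spine_spine // spine_lev //.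
  by case: y vy y1 y2 => y1 y2 _ /= -> ->; rewrite ordered_embedding_spine.
Qed.

End FixedOrder.

Lemma ordered_embedding_eq i j : i \in birth_orders -> j \in birth_orders ->
  ordered_embedding i =1 ordered_embedding j -> i = j.
Proof.
move=> iO jO E.
have si : levt i.1 = r by move: iO; rewrite inE => /andP[/eqP].
have sj : levt j.1 = r by move: jO; rewrite inE => /andP[/eqP].
have spine_r s : spine s r = s by rewrite /spine subnn.
have ij1 : i.1 = j.1.
  have : on_spine j.1 i.1.
    apply: (ordered_embedding_nil jO); rewrite -E ordered_embedding_spine //.
    by rewrite -{2}(spine_r i.1) on_spine_spine.
  by rewrite /on_spine si spine_r => /eqP.
have on w : perm_on (side_children i.1 w) (i.2 w).
  by move: iO; rewrite inE => /andP[_ /familyP]; apply.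
have onj w : perm_on (side_children i.1 w) (j.2 w).
  by move: jO; rewrite inE ij1 => /andP[_ /familyP]; apply.
rewrite (surjective_pairing i) (surjective_pairing j) ij1; congr pair.
apply/ffunP => w; apply/permP => x.
have [xK|xK] := boolP (x \in side_children i.1 w); last first.
  by rewrite (out_perm (on w)) // (out_perm (onj w)).
have := xK; rewrite inE => /andP[/eqP px xs].
have [Ei _] := ordered_embedding_side iO px xs.
have xs' : ~~ on_spine j.1 x by rewrite -ij1.
have [Ej _] := ordered_embedding_side jO px xs'.
have := E x; rewrite Ei Ej E -ij1 => -[Ex]; have := rcons_injr _ Ex; apply: (index_inj o).
  by rewrite mem_enum (perm_closed _ (on w)).
by rewrite mem_enum (perm_closed _ (onj w)).
Qed.

(** The vertex sent to [(r, [::])] gives [s]. The last letters of the codes of the side children of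
    an inner vertex are their birth ranks and fill an initial segment, which yields the
    permutations. *)
Lemma trunc_iso_ordered n phi :
  @trunc_iso V e o r (path_with_family_trees n) path_level phi ->
  exists2 i, i \in birth_orders & offspring_match i n /\ ordered_embedding i =1 phi.
Proof.
move=> phiI; have [phio inj _ surj _] := phiI.
have /(trunc_isoP t_order t_height (path_tree_order n))[_ vphi pphi ext] := phiI.
have lphi x : path_level (phi x) = levt x.
  move: {2}(levt x) (erefl (levt x)) => l; elim: l x => [|l IH] x lx.
    have -> : x = o by apply/partN; case px: (part x) => [w|//]; rewrite (part_lev px) in lx.
    by rewrite phio levt_o.
  case px: (part x) => [w|]; last by rewrite ((partN x).1 px) levt_o in lx.
  have [_ _ _ pS _] := path_tree_order n.
  have lw := part_lev px; rewrite lw -IH; last by lia.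
  by have [] := pS (phi x) (phi w) (vphi x); rewrite // pphi px.
have [s sE] : exists s, phi s = (r, [::]) by apply: surj; rewrite /path_level ?addn0.
have sr : levt s = r by rewrite -lphi sE /path_level addn0.
have spineE j : (j <= r)%N -> phi (spine s j) = (j, [::]).
  move=> jr; rewrite -(subKn jr); move: (r - j)%N (leq_subr j r) => k {j jr}.
  elim: k => [|k IH] kr; first by rewrite subn0 /spine subnn.
  have jr : (r - k.+1 < r)%N by lia.
  have := pphi (spine s (r - k.+1).+1); rewrite spine_part // subnSK // IH 1?ltnW //.
  by rewrite -(subnSK kr) /= => -[].
have onE x : on_spine s x = ((phi x).2 == [::]).
  apply/idP/eqP => [/eqP ->|x2]; first by rewrite spineE // levt_le.
  apply/eqP/inj; rewrite spineE ?levt_le // -lphi /path_level x2 addn0.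
  by rewrite -x2 -surjective_pairing.
pose h x := last 0%N (phi x).2.
have sideE w x : x \in side_children s w -> phi x = ((phi w).1, rcons (phi w).2 (h x)).
  rewrite inE onE => /andP[/eqP px x2].
  have : path_parent (phi x) = Some (phi w) by rewrite pphi px.
  case/path_parentP => [[c xE]|[x2' _ _]]; last by rewrite x2' in x2.
  by rewrite /h xE /= last_rcons.
have hinj w : {in side_children s w &, injective h}.
  by move=> x y xK yK hxy; apply: inj; rewrite (sideE w) // (sideE w y) // hxy.
have hcard w : (levt w < r)%N ->
    perm_eq (map h (enum (side_children s w))) (iota 0 (n (phi w).1 (phi w).2)).
  move=> wr; apply: uniq_perm; rewrite ?iota_uniq //.
    rewrite map_inj_in_uniq ?enum_uniq // => x y; rewrite !mem_enum; exact: hinj.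
  move=> c; rewrite mem_iota add0n /=; apply/mapP/idP => [[x]|cn].
    rewrite mem_enum => xK ->; have := vphi x.
    by rewrite (sideE w x xK) /= family_vert_rcons => /andP[].
  have [||x xE] := ext w ((phi w).1, rcons (phi w).2 c) wr.
  - by rewrite /= family_vert_rcons cn andbT; exact: vphi.
  - by rewrite path_parent_rcons -surjective_pairing.
  exists x; last by rewrite /h -xE last_rcons.
  rewrite mem_enum inE onE -xE -size_eq0 size_rcons andbT.
  have := pphi x; rewrite -xE path_parent_rcons -surjective_pairing.
  by case: (part x) => //= z [/inj ->].
have cardK w : (levt w < r)%N -> #|side_children s w| = n (phi w).1 (phi w).2.
  by move=> wr; rewrite cardE -(size_map h) (perm_size (hcard w wr)) size_iota.
have K0 w : ~~ (levt w < r)%N -> side_children s w = finset.set0.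
  move=> wr; apply/setP => x; rewrite !inE; apply/negP => /andP[/eqP px _].
  by move: (levt_le x) wr; rewrite (part_lev px) => ->.
have hlt w x : x \in side_children s w -> (h x < #|side_children s w|)%N.
  have [wr|/K0 ->] := boolP (levt w < r)%N; last by rewrite inE.
  move=> xK; have : h x \in map h (enum (side_children s w)).
    by apply: map_f; rewrite mem_enum.
  by rewrite (perm_mem (hcard w wr)) mem_iota add0n cardK.
(* As birth ranks are read off by [index], [x] has to go to the element of rank [h x] in the fixed
   enumeration. *)
pose g w x := if x \in side_children s w then nth x (enum (side_children s w)) (h x) else x.
have gK w x : (g w x \in side_children s w) = (x \in side_children s w).
  rewrite /g; case: ifP => // xK.
  by rewrite -mem_enum mem_nth // -cardE hlt.
have ginj w : injective (g w).
  move=> x y gxy; have xyK : (x \in side_children s w) = (y \in side_children s w).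
    by rewrite -gK gxy gK.
  move: gxy; rewrite /g xyK; case: ifP => // yK.
  have xK : x \in side_children s w by rewrite xyK.
  move/eqP; rewrite (set_nth_default y) -?cardE ?hlt // nth_uniq ?enum_uniq -?cardE ?hlt //.
  by move/eqP/(hinj w); apply.
pose ord : {ffun V -> {perm V}} := [ffun w => perm (@ginj w)].
have iO : (s, ord) \in birth_orders.
  rewrite inE /= sr eqxx; apply/familyP => w; rewrite ffunE.
  apply/fintype.subsetP => x; rewrite inE permE /g; case: ifP => //.
  by rewrite eqxx.
have phiE : ordered_embedding (s, ord) =1 phi.
  move=> x; move: {2}(levt x) (erefl (levt x)) => l; elim: l x => [|l IH] x lx.
    have -> : x = o by apply/partN; case px: (part x) => [w|//]; rewrite (part_lev px) in lx.
    by rewrite ordered_embedding_spine ?on_spine_root // phio levt_o.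
  have [xs|xs] := boolP (on_spine s x).
    by rewrite ordered_embedding_spine // (eqP xs) spineE ?levt_le // spine_lev ?levt_le.
  case px: (part x) => [w|]; last by rewrite ((partN x).1 px) on_spine_root in xs.
  have [-> _] := ordered_embedding_side iO px xs.
  have xK : x \in side_children s w by rewrite inE px eqxx.
  rewrite IH; last by have := part_lev px; lia.
  rewrite (sideE w x xK) ffunE permE /g xK index_uniq ?enum_uniq //.
  by rewrite -cardE hlt.
exists (s, ord) => //; split => //; apply/forallP => w; apply/implyP => wr.
by rewrite !phiE cardK.
Qed.

Lemma card_offspring_match n :
  (\sum_(i in birth_orders) offspring_match i n =
   #|automorphisms e o| *
    `[< riso (trunc (path_with_family_trees n) r) (finite_rgraph e o) >])%N.
Proof.
pose s := [seq i <- enum birth_orders | offspring_match i n].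
transitivity (size s).
  by rewrite size_filter -sum1_count big_enum_cond -big_mkcondr.
have memE i : (i \in s) = offspring_match i n && (i \in birth_orders).
  by rewrite mem_filter; congr (_ && _); apply: mem_enum.
apply: (card_trunc_iso (path_tree_order n) (Phi := ordered_embedding)).
- by rewrite filter_uniq //; apply: enum_uniq.
- move=> i j; rewrite !memE => /andP[_ iO] /andP[_ jO].
  exact: ordered_embedding_eq.
- move=> i; rewrite memE => /andP[im iO].
  apply/(trunc_isoP t_order t_height (path_tree_order n)).
  exact: ordered_embedding_local_iso.
- move=> phi /trunc_iso_ordered[i iO [im iE]]; exists i => //.
  by rewrite memE im iO.
Qed.

(** For each [s] the number of orders is the product of the factorials of the numbers of side
    children, which cancels the denominators of the Poisson weights; so every [s] of level [r]
    contributes the same. *)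
Lemma sum_birth_orders (K : comNzRingType) (f : nat -> K) (c : K) :
  (forall m, m`!%:R * f m = c) ->
  \sum_(i in birth_orders) \prod_(w | (levt w < r)%N) f #|side_children i.1 w| =
  #|[pred x | levt x == r]|%:R * c ^+ #|[pred x | (levt x < r)%N]|.
Proof.
move=> fc.
rewrite (eq_bigl (fun i => (levt i.1 == r) &&
  (i.2 \in family (fun w => perm_on (side_children i.1 w))))); last by move=> i; rewrite inE.
rewrite -(pair_big_dep (fun s => levt s == r)
  (fun s (g : {ffun V -> {perm V}}) => g \in family (fun w => perm_on (side_children s w)))
  (fun s _ => \prod_(w | (levt w < r)%N) f #|side_children s w|)) /=.
rewrite mulr_natl -sumr_const; apply: eq_bigr => s _.
rewrite sumr_const card_family /= -mulr_natl.
rewrite (_ : foldr _ _ _ = \prod_w (#|side_children s w|)`!)%N; last first.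
  by rewrite foldrE big_image /=; apply: eq_bigr => w _; rewrite card_perm.
rewrite natr_prod (bigID (fun w => (levt w < r)%N)) /= [X in _ * X * _]big1 => [|w wr].
  rewrite mulr1 -big_split /= -prodr_const; apply: eq_bigr => w _.
  exact: fc.
suff -> : side_children s w = finset.set0 by rewrite cards0 fact0.
apply/setP => x; rewrite !inE; apply/negP => /andP[/eqP px _].
by move: (levt_le x) wr; rewrite (part_lev px) => ->.
Qed.

End OrderedEmbeddings.

Section PathTreeLaw.
Context (R : realType) (d : measure_display) (Omega : measurableType d).
Context (P : probability Omega R) (xi : nat -> seq nat -> {RV P >-> nat}).
Hypothesis xiP : poisson1_offspring xi.
Context (V : finType) (e : rel V) (o : V) (r : nat).
Context (levt : V -> nat) (part : V -> option V).
Hypothesis t_order : @tree_order (finite_rgraph e o) levt part.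
Hypothesis t_height : height_le (finite_rgraph e o) r.
Local Notation phi := (ordered_embedding o r levt part).

Definition match_event i : set Omega :=
  [set omega | offspring_match o r levt part i (fun j u => xi j u omega)].

Let low i : seq (nat * seq nat) := [seq phi i w | w <- enum [pred w | (levt w < r)%N]].

(** Independence is stated for sets indexed by individuals, hence the quantification over the
    vertices sent to [y]; by injectivity there is at most one for a birth order. *)
Let offspring_set i (y : nat * seq nat) : set nat :=
  [set n | forall w, (levt w < r)%N -> phi i w = y ->
     n = #|side_children o r levt part i.1 w|].

Let match_eventE i : match_event i =
  \bigcap_(y in [set y | y \in low i]) ((xi y.1 y.2 : Omega -> nat) @^-1` offspring_set i y).
Proof.
apply/seteqP; split=> [omega /forallP h y /= /mapP[w + ->] w' w'r E|omega h].
  by move=> _; have := implyP (h w') w'r; rewrite E => /eqP.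
apply/forallP => w; apply/implyP => wr; apply/eqP.
apply: (h (phi i w) _ w wr erefl) => /=.
by apply: map_f; rewrite mem_enum.
Qed.

Lemma measurable_match_event i : measurable (match_event i).
Proof.
rewrite match_eventE; apply: fin_bigcap_measurable => [|y _].
  exact: finite_seq.
exact: measurable_funPTI.
Qed.

Lemma probability_match_event i : i \in birth_orders o r levt part ->
  P (match_event i) =
  (\prod_(w | (levt w < r)%N) poisson_pmf 1 #|side_children o r levt part i.1 w|)%:E.
Proof.
move=> iO; have [pmf indep] := xiP.
have inj := ordered_embedding_inj t_order t_height iO.
rewrite match_eventE (indep (low i) (offspring_set i)); last first.
  by rewrite map_inj_uniq ?enum_uniq.
rewrite -prodEFin /low big_map big_enum /=; apply: eq_bigr => w wr.
rewrite -(pmf (phi i w).1 (phi i w).2); congr (P (_ @^-1` _)).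
apply/seteqP; split=> [n /(_ w wr erefl) -> //|n -> w' w'r /inj -> //].
Qed.

Lemma path_tree_law :
  law P (P1_tree xi) (fun T => riso (trunc T r) (finite_rgraph e o)) =
  #|[pred x | levt x == r]|%:R * expR (- #|[pred x | (levt x < r)%N]|%:R)
    / #|automorphisms e o|%:R :> R.
Proof.
pose c : R := #|automorphisms e o|%:R.
have c0 : 0 < c by rewrite ltr0n automorphisms_gt0.
set B := [set omega | riso (trunc (P1_tree xi omega) r) (finite_rgraph e o)].
(* This pointwise count shows that [B] is the finite union of the matching events, hence measurable;
   integrated, it gives the probability of [B]. *)
have cntE omega : \sum_(i in birth_orders o r levt part) \1_(match_event i) omega =
    c * \1_B omega :> R.
  have := card_offspring_match t_order t_height (fun j u => xi j u omega).
  move=> /(congr1 (fun n : nat => n%:R : R)); rewrite natr_sum natrM => E.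
  rewrite /c indicE (_ : (omega \in B) = `[< B omega >]) -?E //.
  apply: eq_bigr => i _; rewrite indicE; congr ((nat_of_bool _)%:R).
  by apply/idP/idP; rewrite inE.
have BE : B = \big[setU/set0]_(i in birth_orders o r levt part) match_event i.
  apply/seteqP; split=> omega.
    move=> oB; have := cntE omega; rewrite indicE mem_set // mulr1 => E.
    have /existsP[i /andP[iO iE]] : [exists i, (i \in birth_orders o r levt part) && (omega \in match_event i)].
      apply: contraTT isT; rewrite negb_exists => /forallP h.
      have : c = 0.
        rewrite -E big1 // => i iO; have := h i; rewrite iO /= indicE => /negbTE -> //.
      by move=> cz; rewrite cz ltxx in c0.
    by rewrite (bigD1 i) //=; left; apply: set_mem.
  have : \big[setU/set0]_(i in birth_orders o r levt part) match_event i `<=` B.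
    apply: (big_ind (fun A => A `<=` B)) => [//|A A' AB A'B|i iO omega' im].
      by rewrite subUset.
    have := cntE omega'; have [//|nB] := pselect (B omega').
    rewrite [\1_B _]indicE memNset // mulr0 => /eqP.
    rewrite psumr_eq0 => [|j _]; last by rewrite indicE.
    by move/allP => /(_ i (mem_index_enum _)); rewrite iO /= indicE mem_set // oner_eq0.
  exact.
have mB : measurable B.
  by rewrite BE; apply: bigsetU_measurable => i _; apply: measurable_match_event.
have : (c%:E * P B = \sum_(i in birth_orders o r levt part) P (match_event i))%E.
  transitivity (\int[P]_omega (c%:E * (\1_B omega)%:E))%E.
    rewrite ge0_integralZl //.
    - by rewrite integral_indic // setIT.
    - by apply/measurable_realfun.measurable_EFinP; exact: measurable_realfun.measurable_indic.
    - by rewrite lee_fin ltW.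
  transitivity (\int[P]_omega \sum_(i <- enum (birth_orders o r levt part)) (\1_(match_event i) omega)%:E)%E.
    apply: eq_integral => omega _.
    by rewrite -EFinM -cntE -sumEFin big_enum.
  rewrite ge0_integral_sum //.
  - rewrite big_enum; apply: eq_bigr => i _.
    by rewrite integral_indic ?setIT //; apply: measurable_match_event.
  - move=> i; apply/measurable_realfun.measurable_EFinP; apply: measurable_realfun.measurable_indic.
    exact: measurable_match_event.
under eq_bigr => i iO do rewrite probability_match_event //.
(* For Poisson(1), the factorial of [m] times the weight of [m] is [expR (-1)] for every [m]. *)
rewrite sumEFin (sum_birth_orders t_order t_height (c := expR (-1))); last first.
  by move=> m; rewrite /poisson_pmf ltr01 expr1n mul1r mulVKf.
move=> E; rewrite /law -/B.
have PB : P B = (fine (P B))%:E by rewrite fineK // fin_num_measure.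
move: E; rewrite PB -EFinM => -[E].
apply: (mulfI (lt0r_neq0 c0)); rewrite mulrCA -/c mulfV ?gt_eqF // mulr1.
rewrite [c * _]E; congr (_ * _).
by rewrite -expRM_natl mulrN mulr1.
Qed.

End PathTreeLaw.

Theorem theorem5p3 (R : realType) (G : nat -> mgraph)
    (v : forall k, vertex (G k))
    (Gconn : forall k, connected_graph (G k))
    (Gmax : one_plus_o1_times (fun k => (max_deg_star (G k))%:R : R)
                              (fun k => k%:R))
    (Gmin : one_plus_o1_times (fun k => (min_deg_star (v k))%:R : R)
                              (fun k => k%:R))
    (GM : uniform_impedance R G)
    (d : measure_display) (Omega : measurableType d)
    (P : probability Omega R) (xi : nat -> seq nat -> {RV P >-> nat})
    (xiP : poisson1_offspring xi) :
  conv_in_distribution (fun k => ust_law R (v k)) (law P (P1_tree xi)).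
Proof.
move=> r V e o t tree_e height_t.
have [lev [par order]] := is_tree_order o tree_e.
rewrite (path_tree_law xiP order height_t).
exact: (ust_trunc_cvg Gconn Gmax Gmin GM order height_t).
Qed.
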